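(* Let $n\ge2$. There exist a $C^\infty$ pseudoconvex real hypersurface $M$ in $\mathbb{C}^{n+1}$ and a point $p\in M$ such that $\Delta_1(M,p)=\infty$ and $\Delta_1^{\rm reg}(M,p)<\infty$ (in particular $M$ is of Bloom-Graham finite type at $p$), and such that there is no $\gamma\in\Gamma$ tangent to $M$ at $p$ to infinite order.
   Context: A local defining function $r$ for $M$ near $p$ is a real-valued $C^\infty$ function with $M=\{r=0\}$ near $p$ and $\nabla r\ne0$ on $M$. $\operatorname{ord}(h)$ is order of vanishing at $0$. $\Gamma$ is the set of germs of nonconstant holomorphic maps $\gamma:(\mathbb{C},0)\to(\mathbb{C}^{n+1},p)$ (good parametrization). $\Delta_1(M,p)=\sup_{\gamma\in\Gamma}\operatorname{ord}(r\circ\gamma)/\operatorname{ord}(\gamma-p)$; $\Delta_1^{\rm reg}(M,p)=\sup\{\operatorname{ord}(r\circ\gamma):\gamma\in\Gamma,\ \operatorname{ord}(\gamma-p)=1\}$. $\gamma$ is tangent to $M$ at $p$ to infinite order if $(r\circ\gamma)(t)=O(t^N)$ for all $N$. Bloom-Graham type of $M$ at $p$ is finite if there is a maximal $m<\infty$ such that some $n$-dimensional complex submanifold $X\ni p$ has $r|_X$ vanishing to order at least $m$ at $p$. *)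

(* Defs.v *)
From HB Require Import structures.
From mathcomp Require Import all_boot all_order all_algebra.
From mathcomp Require Import all_classical all_reals all_analysis.
From mathcomp Require Import complex.
Set Implicit Arguments. Unset Strict Implicit. Unset Printing Implicit Defensive.
Import Order.TTheory GRing.Theory Num.Theory.
Import numFieldNormedType.Exports.
Local Open Scope classical_set_scope.
Local Open Scope ring_scope.

Section Defs.
Variables (R : realType) (n : nat).

(* C^{n+1} in real coordinates: z_j = x_j + i y_j, a point is (x, y). *)
Definition pt := ('rV[R]_n.+1 * 'rV[R]_n.+1)%type.

Definition ex (j : 'I_n.+1) : pt := (\row_k (k == j)%:R, 0).
Definition ey (j : 'I_n.+1) : pt := (0, \row_k (k == j)%:R).

Definition iterD (f : pt -> R) (vs : seq pt) : pt -> R :=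
  foldr (fun v g => 'D_v g) f vs.

Definition smooth_on (U : set pt) (f : pt -> R) :=
  forall (vs : seq pt) (x : pt), U x ->
    (forall v, derivable (iterD f vs) x v) /\ {for x, continuous (iterD f vs)}.

Definition grad_nonzero (r : pt -> R) (x : pt) :=
  exists j, 'D_(ex j) r x != 0 \/ 'D_(ey j) r x != 0.

Definition zcoord (x : pt) (j : 'I_n.+1) : R[i] := Complex (x.1 0 j) (x.2 0 j).

Definition dz (r : pt -> R) (j : 'I_n.+1) (x : pt) : R[i] :=
  Complex ('D_(ex j) r x / 2) (- ('D_(ey j) r x / 2)).

Definition dzdzb (r : pt -> R) (j k : 'I_n.+1) (x : pt) : R[i] :=
  Complex (('D_(ex j) ('D_(ex k) r) x + 'D_(ey j) ('D_(ey k) r) x) / 4)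
          (('D_(ex j) ('D_(ey k) r) x - 'D_(ey j) ('D_(ex k) r) x) / 4).

Definition levi (r : pt -> R) (x : pt) (w : 'I_n.+1 -> R[i]) : R[i] :=
  \sum_(j < n.+1) \sum_(k < n.+1) dzdzb r j k x * w j * conjc (w k).

Definition pseudoconvex_on (U : set pt) (r : pt -> R) :=
  forall x, U x -> r x = 0 ->
    forall w : 'I_n.+1 -> R[i],
      \sum_(j < n.+1) dz r j x * w j = 0 -> 0 <= levi r x w.

(* Germs of holomorphic maps (C,0) -> (C^{n+1}, p), given by their Taylor
   coefficients a k j (coefficient of t^k in component j). *)
Definition coeffs := nat -> 'I_n.+1 -> R[i].

(* positive radius of convergence (Cauchy estimate) *)
Definition conv_coeffs (a : coeffs) :=
  exists (C rho : R), 0 < rho /\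
    forall k j, ComplexField.Normc.normc (a k j) * rho ^+ k <= C.

Definition good_curve (p : pt) (a : coeffs) :=
  [/\ conv_coeffs a, (forall j, a 0%N j = zcoord p j)
    & exists k j, (0 < k)%N /\ a k j != 0].

Definition curve_eval (a : coeffs) (t : R[i]) : pt :=
  (\row_j limn (fun N => complex.Re (\sum_(k < N) a k j * t ^+ k)),
   \row_j limn (fun N => complex.Im (\sum_(k < N) a k j * t ^+ k))).

Definition curve_ord (a : coeffs) (m : nat) :=
  (0 < m)%N /\ (exists j, a m j != 0) /\
  forall k j, (0 < k < m)%N -> a k j = 0.

Definition vanishes_to (h : R[i] -> R) (N : nat) :=
  exists (C delta : R), 0 < delta /\
    forall t, ComplexField.Normc.normc t < delta ->
      `|h t| <= C * ComplexField.Normc.normc t ^+ N.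

Definition ord_van (h : R[i] -> R) : \bar R :=
  ereal_sup [set (N%:R)%:E | N in vanishes_to h].

Definition Delta1 (r : pt -> R) (p : pt) : \bar R :=
  ereal_sup [set x | exists (a : coeffs) (m : nat),
    [/\ good_curve p a, curve_ord a m &
        x = (ord_van (r \o curve_eval a) * ((m%:R)^-1)%:E)%E]].

Definition Delta1reg (r : pt -> R) (p : pt) : \bar R :=
  ereal_sup [set x | exists (a : coeffs),
    [/\ good_curve p a, curve_ord a 1 & x = ord_van (r \o curve_eval a)]].

Definition tangent_inf (r : pt -> R) (a : coeffs) :=
  forall N, vanishes_to (r \o curve_eval a) N.

End Defs.

(* Main.v *)
(* Write z1, z2, w for three of the coordinates. The hypersurface is
     Re w + |z1^2 - z2^3|^2 + sum of the remaining |z_j|^2 + u(z2) = 0,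
   where u is a smooth subharmonic function near 0 in C whose Taylor series at 0 is
   the real part of a divergent holomorphic series h. It is a sum of functions
   eps_k (Re 1/(a_k - z) - 1/a_k), smoothed near the pole a_k = 1/(k+1) and made
   subharmonic by adding a large multiple of exp(-1/|z|^2); the coefficients of h are the
   positive sums of eps_k a_k^(-m-1), so h diverges whatever the weights eps_k > 0.
   The curves (t^3, t^2, -h_N(t^2)), with h_N a Taylor polynomial of h, have arbitrarily
   high contact. Conversely, if a curve has contact N, averaging over roots of unity
   separates the harmonic part Re(w + h_N(z2)) from the sum of squares: both are O(t^N).
   For a regular curve this forces N <= 7, because z1^2 = z2^3 is a cusp; contact of infinite
   order gives w = -h(z2) formally, and dividing repeatedly by z2 bounds the
   coefficients of h geometrically unless z2 = 0, in which case the curve is constant. *)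
Require Import Defs.
From HB Require Import structures.
From mathcomp Require Import all_boot all_order all_algebra.
From mathcomp Require Import all_classical all_reals all_analysis.
From mathcomp Require Import complex.
From mathcomp Require Import ring lra zify cyclic separable cyclotomic.
Set Implicit Arguments. Unset Strict Implicit. Unset Printing Implicit Defensive.
Import Order.TTheory GRing.Theory Num.Theory.
Import numFieldNormedType.Exports.
Local Open Scope classical_set_scope.
Local Open Scope ring_scope.

(** * Flat functions *)

(** Three demands pull against each other. If h converged, (t^3, t^2, -h(t^2)) would be tangent to
    infinite order, so h must diverge. If the cusp were replaced by z1, the regular curves (0, t,
    -h_N(t)) would have unbounded contact, so the curves of high contact must be forced to be
    singular. Finally, Borel's theorem gives a smooth function with any prescribed Taylor series,
    but not a subharmonic one. The poles a_k settle the last point: each summand is already harmonic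
    outside the disc of radius a_k/2 about a_k, hence near 0, and its Laplacian can be negative only
    inside that disc, where |z| > a_k/2 and exp(-1/|z|^2) has Laplacian bounded below by a positive
    constant. The flat corrector leaves the Taylor series at 0 unchanged. Since a_k tends to 0, the
    radii of convergence shrink, and since all coefficients are positive no cancellation can restore
    convergence, however small the weights must be for the sum to be smooth. *)

Lemma cvg_is_derive (K : numFieldType) (V W : normedModType K) (f : V -> W) (x v : V) (l : W) :
  h^-1 *: ((f \o shift x) (h *: v) - f x) @[h --> 0^'] --> l -> is_derive x v f l.
Proof. by move=> h; apply: DeriveDef; [apply: cvgP h | apply/cvg_lim]. Qed.

Section Flat.
Variable R : realType.

(** The factor s^-k makes the span of the family closed under differentiation, so no formula for
    derivatives of general order is needed. *)
Definition flat (k : nat) (s : R) : R := if 0 < s then s ^- k * expR (- s^-1) else 0.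

Lemma flat_le0 k s : s <= 0 -> flat k s = 0.
Proof. by rewrite /flat leNgt => /negbTE ->. Qed.

Lemma flat_ge0 k s : 0 <= flat k s.
Proof.
rewrite /flat; case: ifP => // s0.
by rewrite mulr_ge0 ?expR_ge0 // invr_ge0 exprn_ge0 // ltW.
Qed.

(** Raise x/m <= exp(x/m) to the power m and invert. *)
Lemma expRN_le (m : nat) (x : R) : 0 < x -> expR (- x) <= m%:R ^+ m * x ^- m.
Proof.
move=> x0; case: m => [|m]; first by rewrite !expr0 invr1 mulr1 -[leRHS]expR0 ler_expR oppr_le0 ltW.
have m0 : 0 < m.+1%:R :> R by rewrite ltr0n.
have h : x / m.+1%:R <= expR (x / m.+1%:R).
  by rewrite (le_trans _ (expR_ge1Dx _)) // lerDr.
have E : (x / m.+1%:R) ^+ m.+1 <= expR x.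
  rewrite -[X in expR X](@divfK _ m.+1%:R) ?lt0r_neq0 // expRM_natr lerXn2r //.
    by rewrite nnegrE divr_ge0 // ltW.
  by rewrite nnegrE expR_ge0.
have P : 0 < (x / m.+1%:R) ^+ m.+1 by rewrite exprn_gt0 ?divr_gt0.
rewrite expRN; move: E; rewrite -lef_pV2 ?posrE ?expR_gt0 // => /le_trans -> //.
by rewrite expr_div_n invfM invrK mulrC.
Qed.

Lemma flat_le (k m : nat) : exists2 C : R, 0 <= C & forall s, `|flat k s| <= C * `|s| ^+ m.
Proof.
exists ((k + m)%:R ^+ (k + m)); first exact: exprn_ge0.
move=> s; rewrite ger0_norm ?flat_ge0 // /flat; case: ifP => s0; last first.
  by rewrite mulr_ge0 ?exprn_ge0.
have sn0 : s != 0 by rewrite gt_eqF.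
rewrite (gtr0_norm s0) -(@ler_pM2l _ (s ^+ k)) ?exprn_gt0 //.
rewrite mulrA divff ?expf_neq0 // mul1r.
have := @expRN_le (k + m) s^-1; rewrite invr_gt0 => /(_ s0) /le_trans -> //.
by rewrite -exprVn invrK (exprD s) mulrCA.
Qed.

Lemma is_derive_flat k (s : R) :
  is_derive s 1 (flat k) (flat k.+2 s - k%:R * flat k.+1 s).
Proof.
case: (ltgtP s 0) => s0.
- rewrite !flat_le0 ?(ltW s0) // mulr0 subr0.
  apply: (@near_eq_is_derive _ _ _ (cst 0)) => //.
  by near=> y; rewrite flat_le0 //; apply/ltW; near: y; exact: lt_nbhsl.
- have sn0 : s != 0 by rewrite gt_eqF.
  apply: (@near_eq_is_derive _ _ _ (fun y : R => (y^-1) ^+ k * expR (- y^-1) : R)) => //.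
  + by near=> y; rewrite /flat ifT ?exprVn //; near: y; exact: lt_nbhsr.
  rewrite /flat s0.
  have dV : is_derive s 1 (fun y : R => y^-1) (- s ^- 2).
    apply: DeriveDef; first exact: derivableV.
    by rewrite deriveV // derive_id scaler1 -?mulNr.
  have dX : is_derive s 1 (fun y : R => (y^-1) ^+ k) (k%:R * s^-1 ^+ k.-1 * (- s ^- 2)).
    by have := is_deriveX k dV; rewrite exprfctE.
  have dE : is_derive s 1 (fun y : R => expR (- y^-1)) (expR (- s^-1) * s ^- 2).
    apply: (@is_derive1_comp _ expR (fun y => - y^-1)).
    by rewrite -[s ^- 2]opprK; exact: is_deriveN dV.
  have := is_deriveM dX dE; rewrite mulrfctE => H; apply: is_derive_eq.
  rewrite /GRing.scale /= -!exprVn; set u := s^-1; set E := expR _.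
  by clear; case: k => [|k]; rewrite /= ?exprS ?expr0; ring.
- rewrite s0 !flat_le0 // mulr0 subr0.
  (* Quadratic decay bounds the difference quotient at 0 by C|h|; [C + 1] below allows division when
     C is 0. *)
  have [C C0 HC] := flat_le k 2.
  have C1 : 0 < C + 1 by rewrite ltr_wpDl.
  apply: cvg_is_derive; apply/cvgr0Pnorm_le => e e0; near=> h.
  have hn0 : h != 0 by near: h; exact: nbhs_dnbhs_neq.
  rewrite /= [flat k 0]flat_le0 // subr0 addr0 /GRing.scale /= mulr1 normrM normfV.
  rewrite mulrC ler_pdivrMr ?normr_gt0 // (le_trans (HC h)) // expr2 mulrA ler_wpM2r //.
  have : `|h| <= e / (C + 1) by near: h; apply: dnbhs0_le; rewrite divr_gt0 //.
  rewrite ler_pdivlMr // => /(le_trans _) -> //.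
  by rewrite mulrC ler_wpM2l // lerDl.
Unshelve. all: by end_near. Qed.
End Flat.

(** * A class of smooth functions closed under differentiation *)

Section Elem.
Variables (R : realType) (n : nat).
Local Notation V := (pt R n).

(** An inductive class turns differentiability, closure under derivatives and symmetry of second
    derivatives into inductions on the shape of the function. All members are smooth on the whole
    space, which is why inversion asks for a denominator without any zero. *)
Inductive elem : (V -> R) -> Prop :=
| elem_cst c : elem (fun=> c)
| elem_re j : elem (fun x => x.1 0 j)
| elem_im j : elem (fun x => x.2 0 j)
| elemD f g : elem f -> elem g -> elem (fun x => f x + g x)
| elemM f g : elem f -> elem g -> elem (fun x => f x * g x)
| elemV f : elem f -> (forall x, f x != 0) -> elem (fun x => (f x)^-1)
| elem_flat k f : elem f -> elem (fun x => flat k (f x)).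

Lemma elemN f : elem f -> elem (fun x => - f x).
Proof.
move=> ef; rewrite (_ : (fun x => - f x) = (fun x => (fun=> -1) x * f x)).
  by apply: elemM => //; exact: elem_cst.
by apply/funext => x; rewrite mulN1r.
Qed.

Lemma elemZ c f : elem f -> elem (fun x => c * f x).
Proof. by move=> ef; apply: (elemM (elem_cst c) ef). Qed.

Lemma elemB f g : elem f -> elem g -> elem (fun x => f x - g x).
Proof. by move=> ef /elemN; exact: elemD. Qed.

Lemma elem_sum (I : Type) (r : seq I) (P : pred I) (F : I -> V -> R) :
  (forall i, P i -> elem (F i)) -> elem (fun x => \sum_(i <- r | P i) F i x).
Proof.
move=> eF; elim: r => [|i r IH].
  rewrite (_ : (fun _ => _) = (fun=> 0)); first exact: elem_cst.
  by apply/funext => x; rewrite big_nil.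
rewrite (_ : (fun _ => _) = (fun x => (if P i then F i x else 0) +
    (fun x => \sum_(j <- r | P j) F j x) x)).
  apply: elemD => //; case: (boolP (P i)) => Pi; last exact: elem_cst.
  exact: eF.
by apply/funext => x; rewrite big_cons; case: ifP => //; rewrite add0r.
Qed.

Lemma re_linear j : linear (fun x : V => x.1 0 j).
Proof. by move=> a x y /=; rewrite !mxE. Qed.
Lemma im_linear j : linear (fun x : V => x.2 0 j).
Proof. by move=> a x y /=; rewrite !mxE. Qed.

Lemma re_is_diff j (x : V) : is_diff x (fun x : V => x.1 0 j) (fun x : V => x.1 0 j).
Proof.
pose fM := GRing.isLinear.Build _ _ _ _ _ (@re_linear j).
pose fL : {linear V -> R} := HB.pack (fun x : V => x.1 0 j) fM.
have c : continuous fL.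
  move=> y /=; apply: (@continuous_comp _ _ _ fst (fun M : 'rV[R]_n.+1 => M 0 j)).
    exact: cvg_fst.
  exact: coord_continuous.
rewrite (_ : (fun x : V => x.1 0 j) = fL) //.
by apply: DiffDef; [exact: linear_differentiable|exact: diff_lin].
Qed.

Lemma im_is_diff j (x : V) : is_diff x (fun x : V => x.2 0 j) (fun x : V => x.2 0 j).
Proof.
pose fM := GRing.isLinear.Build _ _ _ _ _ (@im_linear j).
pose fL : {linear V -> R} := HB.pack (fun x : V => x.2 0 j) fM.
have c : continuous fL.
  move=> y /=; apply: (@continuous_comp _ _ _ snd (fun M : 'rV[R]_n.+1 => M 0 j)).
    exact: cvg_snd.
  exact: coord_continuous.
rewrite (_ : (fun x : V => x.2 0 j) = fL) //.
by apply: DiffDef; [exact: linear_differentiable|exact: diff_lin].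
Qed.

Lemma flat_differentiable k (s : R) : differentiable (flat k) s.
Proof. by apply/derivable1_diffP; case: (is_derive_flat k s). Qed.

Lemma elem_differentiable f x : elem f -> differentiable f x.
Proof.
elim=> {f} [c|j|j|f g _ df _ dg|f g _ df _ dg|f _ df f0|k f _ df].
- exact: differentiable_cst.
- by case: (re_is_diff j x).
- by case: (im_is_diff j x).
- exact: differentiableD.
- exact: differentiableM.
- exact: differentiableV.
- by apply: differentiable_comp => //; exact: flat_differentiable.
Qed.

Lemma elem_derivable f x v : elem f -> derivable f x v.
Proof. by move=> /(elem_differentiable x); exact: diff_derivable. Qed.

Lemma elem_continuous f : elem f -> continuous f.
Proof. by move=> ef x; apply: differentiable_continuous; exact: elem_differentiable. Qed.

Fact dd_subproof : {d : V -> (V -> R) -> V -> R | forall v f, d v f = 'D_v f}.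
Proof. by exists (fun v f => 'D_v f). Qed.

(* Opaque, so that mismatched directions are never compared by unfolding limits. *)
Definition dd (v : V) (f : V -> R) : V -> R := sval dd_subproof v f.

Lemma ddE v f : dd v f = 'D_v f.
Proof. exact: (svalP dd_subproof). Qed.

Lemma dd_cst c v : dd v (fun=> c) = (fun=> 0).
Proof. by rewrite ddE; apply/funext => x; exact: derive_cst. Qed.

Lemma dd_re j v : dd v (fun x => x.1 0 j) = (fun=> v.1 0 j).
Proof.
rewrite ddE; apply/funext => x; have [d e] := re_is_diff j x.
by rewrite deriveE // e.
Qed.

Lemma dd_im j v : dd v (fun x => x.2 0 j) = (fun=> v.2 0 j).
Proof.
rewrite ddE; apply/funext => x; have [d e] := im_is_diff j x.
by rewrite deriveE // e.
Qed.

Lemma ddD f g v : elem f -> elem g -> dd v (fun x => f x + g x) = (fun x => dd v f x + dd v g x).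
Proof.
by move=> ef eg; rewrite !ddE; apply/funext => x; rewrite deriveD //; exact: elem_derivable.
Qed.

Lemma ddM f g v : elem f -> elem g ->
  dd v (fun x => f x * g x) = (fun x => f x * dd v g x + g x * dd v f x).
Proof.
by move=> ef eg; rewrite !ddE; apply/funext => x; rewrite deriveM //; exact: elem_derivable.
Qed.

Lemma ddZ c f v : elem f -> dd v (fun x => c * f x) = (fun x => c * dd v f x).
Proof.
move=> ef; rewrite ddM ?dd_cst //; last exact: elem_cst.
by apply/funext => x; rewrite mulr0 addr0.
Qed.

Lemma ddN f v : elem f -> dd v (fun x => - f x) = (fun x => - dd v f x).
Proof.
move=> ef; rewrite (_ : (fun x => - f x) = (fun x => -1 * f x)); last first.
  by apply/funext => x; rewrite mulN1r.
by rewrite ddZ //; apply/funext => x; rewrite mulN1r.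
Qed.

Lemma ddB f g v : elem f -> elem g -> dd v (fun x => f x - g x) = (fun x => dd v f x - dd v g x).
Proof. by move=> ef eg; rewrite (ddD _ ef (elemN eg)) ddN. Qed.

Lemma ddV f v : elem f -> (forall x, f x != 0) ->
  dd v (fun x => (f x)^-1) = (fun x => - ((f x)^-1 * (f x)^-1) * dd v f x).
Proof.
move=> ef f0; rewrite !ddE; apply/funext => x; rewrite deriveV //; last exact: elem_derivable.
by rewrite expr2 invfM.
Qed.

Lemma dd_flat k f v : elem f ->
  dd v (fun x => flat k (f x)) =
  (fun x => (flat k.+2 (f x) - k%:R * flat k.+1 (f x)) * dd v f x).
Proof.
move=> ef; rewrite !ddE; apply/funext => x.
have df := elem_differentiable x ef.
have dk := flat_differentiable k (f x).
rewrite deriveE; last exact: differentiable_comp.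
have [_ e] := is_derive_flat k (f x).
by rewrite diff_comp //= diff1E //= derive1E e -(deriveE v df) [RHS]mulrC.
Qed.

Lemma elem_dd f v : elem f -> elem (dd v f).
Proof.
elim=> {f} [c|j|j|f g ef df eg dg|f g ef df eg dg|f ef df f0|k f ef df].
- by rewrite dd_cst; exact: elem_cst.
- by rewrite dd_re; exact: elem_cst.
- by rewrite dd_im; exact: elem_cst.
- by rewrite ddD //; exact: elemD.
- by rewrite ddM //; apply: elemD; exact: elemM.
- rewrite ddV //; apply: elemM => //; apply: elemN.
  by apply: elemM; exact: elemV.
- rewrite dd_flat //; apply: elemM => //.
  by apply: elemB; [exact: elem_flat|apply: elemZ; exact: elem_flat].
Qed.

(** Induction on the class replaces Schwarz's theorem: both sides are computed by the derivation
    rules and compared by [ring]. *)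
Lemma ddC f v w : elem f -> dd v (dd w f) = dd w (dd v f).
Proof.
elim=> {f} [c|j|j|f g ef df eg dg|f g ef df eg dg|f ef df f0|k f ef df].
- by rewrite !dd_cst.
- by rewrite !dd_re !dd_cst.
- by rewrite !dd_im !dd_cst.
- have e u := (elem_dd u ef, elem_dd u eg).
  by rewrite !(ddD _ ef eg) !(ddD _ (e _).1 (e _).2) df dg.
- have e u := (elem_dd u ef, elem_dd u eg).
  rewrite !(ddM _ ef eg) !(ddD _ (elemM ef (e _).2) (elemM eg (e _).1)).
  rewrite !(ddM _ ef (e _).2) !(ddM _ eg (e _).1) df dg; apply/funext => x.
  move: (dd v f x) (dd w f x) (dd v g x) (dd w g x) (dd w (dd v f) x) (dd w (dd v g) x).
  by move=> *; ring.
- have e u := elem_dd u ef; have eV := elemV ef f0.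
  have e2 : elem (fun x => - ((f x)^-1 * (f x)^-1)) by apply: elemN; exact: elemM.
  rewrite !(ddV _ ef f0) !(ddM _ e2 (e _)) !(ddN _ (elemM eV eV)) !(ddM _ eV eV).
  rewrite !(ddV _ ef f0) df; apply/funext => x.
  by move: (dd v f x) (dd w f x) (dd w (dd v f) x) => *; ring.
- have e u := elem_dd u ef.
  have ek i : elem (fun x => flat i (f x)) by exact: elem_flat.
  have e2 := elemB (ek k.+2) (elemZ k%:R (ek k.+1)).
  rewrite !(dd_flat _ _ ef) !(ddM _ e2 (e _)) !(ddB _ (ek _) (elemZ _ (ek _))).
  rewrite !(ddZ _ _ (ek _)) !(dd_flat _ _ ef) df; apply/funext => x.
  by move: (dd v f x) (dd w f x) (dd w (dd v f) x) => *; ring.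
Qed.

Lemma iterD_dd f vs : Defs.iterD f vs = foldr dd f vs.
Proof. by elim: vs => //= v vs ->; rewrite ddE. Qed.

End Elem.
Arguments dd {R n} v f _.
Arguments elem_cst {R n} c.
Arguments elem_re {R n} j.
Arguments elem_im {R n} j.

(** * Dominated series *)

Section Series.
Variable R : realType.
Implicit Types a b M : nat -> R.

Lemma dominated_cvg a M : cvgn (series M) -> (forall k, `|a k| <= M k) -> cvgn (series a).
Proof.
move=> cM aM; apply: normed_cvg.
have M0 k : 0 <= M k by apply: le_trans (aM k); exact: normr_ge0.
by apply: (series_le_cvg _ M0 aM cM) => k; exact: normr_ge0.
Qed.

Lemma dominated_tail a M N : cvgn (series M) -> (forall k, `|a k| <= M k) ->
  `|limn (series a) - series a N| <= limn (series M) - series M N.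
Proof.
move=> cM aM; have ca := dominated_cvg cM aM.
have M0 k : 0 <= M k by apply: le_trans (aM k); exact: normr_ge0.
have cD : (`|series a n - series a N|) @[n --> \oo] --> `|limn (series a) - series a N|.
  by apply: cvg_norm; apply: cvgB => //; exact: cvg_cst.
rewrite -(cvg_lim _ cD) //; apply: limr_le; first exact: cvgP cD.
near=> n; have Nn : (N <= n)%N by near: n; exact: nbhs_infty_ge.
apply: (@le_trans _ _ (series M n - series M N)).
  rewrite !sub_series Nn; apply: le_trans (ler_norm_sum _ _ _) _.
  exact: ler_sum.
rewrite lerB //; apply: nondecreasing_cvgn_le => // i j ij.
by rewrite -subr_ge0 sub_series ij sumr_ge0.
Unshelve. all: by end_near. Qed.

Lemma dominated_sum a M : cvgn (series M) -> (forall k, `|a k| <= M k) ->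
  `|limn (series a)| <= limn (series M).
Proof.
move=> cM aM; have := dominated_tail 0 cM aM.
by rewrite /series /= !big_geq // !subr0.
Qed.

(** Dominated convergence for series along a filter. It serves twice: at nearby points for
    continuity of a sum, and on difference quotients for termwise differentiation. *)
Lemma tannery (T : Type) (F : set_system T) (FF : Filter F) (f : nat -> T -> R) a M :
  cvgn (series M) -> (forall k, f k t @[t --> F] --> a k) ->
  (\forall t \near F, forall k, `|f k t| <= M k) -> (forall k, `|a k| <= M k) ->
  limn (series (fun k => f k t)) @[t --> F] --> limn (series a).
Proof.
move=> cM fa fM aM; apply/cvgrPdist_le => e e0.
have e3 : 0 < e / 3 by rewrite divr_gt0.
have [N _ /(_ N (leqnn N)) HN] := (cvgrPdist_le _ _).1 cM _ e3.
have fN : (series (fun k => f k t) N) @[t --> F] --> series a N.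
  rewrite /series /=; apply: cvg_big => [|i _]; last exact: fa.
  exact: add_continuous.
have fN3 := (cvgrPdist_le _ _).1 fN _ e3.
near=> t.
have Ht : `|series a N - series (fun k => f k t) N| <= e / 3 by near: t; exact: fN3.
have tM : forall k, `|f k t| <= M k by near: t; exact: fM.
have h1 := dominated_tail N cM aM; have h2 := dominated_tail N cM tM.
have h3 : limn (series M) - series M N <= e / 3 by exact: le_trans (ler_norm _) HN.
rewrite (_ : _ - _ = (limn (series a) - series a N) + (series a N - series (fun k => f k t) N)
  - (limn (series (fun k => f k t)) - series (fun k => f k t) N)); last by ring.
apply: le_trans (ler_normB _ _) _; apply: le_trans (lerD (ler_normD _ _) (lexx _)) _.
move: h1 h2 h3 Ht => /=; lra.
Unshelve. all: by end_near. Qed.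


Lemma summable_half (A : R) : cvgn (series (fun k => A * 2^-1 ^+ k)).
Proof. by apply: (@is_cvg_geometric_series _ A); rewrite ger0_norm ?invf_lt1 ?ltr1n. Qed.

(** Diagonal choice: the k-th weight is divided by a bound for the first k+1 entries of row k, so
    column N is controlled by 2^-k as soon as k >= N. *)
Lemma diagonal_weights (B : nat -> nat -> R) : exists2 eps : nat -> R, forall k, 0 < eps k &
  forall N, exists A, forall k, eps k * `|B k N| <= A * 2^-1 ^+ k.
Proof.
pose D k := 1 + \sum_(i < k.+1) `|B k i|.
have D0 k : 0 < D k by rewrite ltr_wpDr // sumr_ge0.
have p0 k : 0 < 2^-1 ^+ k :> R by rewrite exprn_gt0.
pose eps k := 2^-1 ^+ k / D k.
have e0 k : 0 < eps k by rewrite divr_gt0.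
exists eps => // N.
(* The 1 serves all k >= N; the finitely many rows before N are absorbed by the sum. *)
exists (1 + \sum_(i < N) eps i * `|B i N| / 2^-1 ^+ i) => k.
have [Nk|kN] := leqP N k.
  apply: (@le_trans _ _ (2^-1 ^+ k)); last first.
    rewrite ler_peMl ?(ltW (p0 _)) // lerDl sumr_ge0 // => i _.
    by apply: divr_ge0; [apply: mulr_ge0 => //; exact: ltW|exact: ltW].
  rewrite /eps mulrAC ler_pdivrMr // ler_wpM2l ?(ltW (p0 _)) //.
  rewrite /D (bigD1 (Ordinal (n := k.+1) (m := N) Nk)) //= addrCA lerDl addr_ge0 //.
  exact: sumr_ge0.
rewrite -ler_pdivrMr // (bigD1 (Ordinal kN)) //= addrCA lerDl addr_ge0 //.
by rewrite sumr_ge0 // => i _; apply: divr_ge0; [apply: mulr_ge0 => //; exact: ltW|exact: ltW].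
Qed.

End Series.

(** * Uniform bounds for derivatives near the origin *)

Section Bounds.
Variables (R : realType) (n : nat).
Local Notation V := (pt R n).

Implicit Types (f g : V -> R) (v w x : V) (vs : seq V).

(** The norm is the maximum of the real coordinates, so radius 1/2 gives |z_j|^2 < 1/2. This keeps
    the Laplacian of [bowl] nonnegative and the powers of |z_j| at most 1. *)
Definition box : set V := [set x | `|x| < 2^-1].

Lemma box_open : open box.
Proof.
rewrite (_ : box = ball (0 : V) 2^-1); first exact: ball_open.
by apply/seteqP; split=> x; rewrite -ball_normE /box /ball_ /= sub0r normrN.
Qed.

Lemma box0 : box 0.
Proof. by rewrite /box /= normr0. Qed.

Lemma compact_half_ball m : compact [set v : 'rV[R]_m | `|v| <= 2^-1].
Proof.
apply: bounded_closed_compact.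
  exists 2^-1; split; first exact: num_real.
  by move=> M hM v /= /le_trans -> //; exact: ltW.
rewrite (_ : [set _ | _] = (@Num.norm R _) @^-1` [set y | y <= 2^-1]) //.
by apply: closed_comp => [v _|]; [exact: norm_continuous|exact: closed_le].
Qed.

Lemma elem_bounded f : elem f -> exists2 C, 0 <= C & forall x : V, box x -> `|f x| <= C.
Proof.
move=> ef.
have := compact_setX (@compact_half_ball n.+1) (@compact_half_ball n.+1).
have fc : {within ([set v : 'rV[R]_n.+1 | `|v| <= 2^-1] `*` [set v : 'rV[R]_n.+1 | `|v| <= 2^-1]), continuous f}.
  by apply: continuous_subspaceT; exact: elem_continuous.
move=> /(continuous_compact fc) /compact_bounded [M [_ HM]].
exists (`|M| + 1) => [|x]; first by rewrite addr_ge0.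
rewrite /box /= prod_normE gt_max => /andP[h1 h2].
apply: (HM (`|M| + 1)); first by rewrite (le_lt_trans (ler_norm _)) // ltrDl.
by exists x => //; split; exact: ltW.
Qed.

Definition basis (i : 'I_n.+1 + 'I_n.+1) : V :=
  match i with inl j => ex R j | inr j => ey R j end.
Definition co (v : V) (i : 'I_n.+1 + 'I_n.+1) : R :=
  match i with inl j => v.1 0 j | inr j => v.2 0 j end.

Lemma dd_basis f v : elem f -> dd v f = (fun x => \sum_i co v i * dd (basis i) f x).
Proof.
move=> ef; apply/funext => x; rewrite ddE; have df := elem_differentiable x ef.
under eq_bigr do rewrite ddE deriveE //.
rewrite deriveE // big_sumType /= -[in LHS](_ : \sum_j v.1 0 j *: ex R j + \sum_j v.2 0 j *: ey R j = v).
  by rewrite linearD !linear_sum /=; congr (_ + _); apply: eq_bigr => j _; rewrite linearZ.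
apply: injective_projections; rewrite /= !raddf_sum /=.
- rewrite [X in _ + X]big1 ?addr0 => [|j _]; last by rewrite scaler0.
  apply/rowP => k; rewrite summxE (bigD1 k) //= !mxE eqxx mulr1 big1 ?addr0 // => j jk.
  by rewrite !mxE eq_sym (negbTE jk) mulr0.
- rewrite [X in X + _]big1 ?add0r => [|j _]; last by rewrite scaler0.
  apply/rowP => k; rewrite summxE (bigD1 k) //= !mxE eqxx mulr1 big1 ?addr0 // => j jk.
  by rewrite !mxE eq_sym (negbTE jk) mulr0.
Qed.

Lemma elem_foldr_dd f vs : elem f -> elem (foldr dd f vs).
Proof. by move=> ef; elim: vs => //= v vs IH; exact: elem_dd. Qed.

Lemma dd_sum (I : Type) (r : seq I) (F : I -> V -> R) v : (forall i, elem (F i)) ->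
  dd v (fun x => \sum_(i <- r) F i x) = (fun x => \sum_(i <- r) dd v (F i) x).
Proof.
move=> eF; elim: r => [|i r IH].
  under eq_fun do rewrite big_nil; rewrite dd_cst.
  by apply/funext => x; rewrite big_nil.
under eq_fun do rewrite big_cons; rewrite ddD // ?IH; last exact: elem_sum.
by apply/funext => x; rewrite big_cons.
Qed.

Lemma foldr_dd_lin (I : Type) (r : seq I) (c : I -> R) (F : I -> V -> R) vs :
  (forall i, elem (F i)) ->
  foldr dd (fun x => \sum_(i <- r) c i * F i x) vs =
  (fun x => \sum_(i <- r) c i * foldr dd (F i) vs x).
Proof.
move=> eF; elim: vs => //= v vs ->.
have e i : elem (foldr dd (F i) vs) by exact: elem_foldr_dd.
rewrite (dd_sum _ _ (fun i => elemZ (c i) (e i))); apply/funext => x.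
by apply: eq_bigr => i _; rewrite ddZ.
Qed.

Definition conorm (v : V) : R := \sum_i `|co v i|.

(** One constant must serve all lists of m directions: there are uncountably many lists, whereas the
    weights can only be chosen against countably many bounds. Multilinearity reduces everything to
    basis directions. *)
Lemma foldr_dd_bounded m f : elem f -> exists2 C, 0 <= C &
  forall vs, size vs = m -> forall x, box x -> `|foldr dd f vs x| <= C * \prod_(v <- vs) conorm v.
Proof.
elim: m f => [|m IH] f ef.
  have [C C0 HC] := elem_bounded ef; exists C => // vs /size0nil -> x /HC.
  by rewrite big_nil mulr1.
have H i : exists C, 0 <= C /\ forall vs, size vs = m -> forall x, box x ->
   `|foldr dd (dd (basis i) f) vs x| <= C * \prod_(v <- vs) conorm v.
  by have [C C0 HC] := IH _ (elem_dd (basis i) ef); exists C.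
have [C HC] := choice H.
have C0 i : 0 <= C i by case: (HC i).
exists (\sum_i C i) => [|vs]; first exact: sumr_ge0.
(* The last direction is differentiated first. Expanding it in the basis leaves finitely many
   functions [dd (basis i) f], to which the induction hypothesis applies. *)
case/lastP: vs => // vs v; rewrite size_rcons => -[szvs] x Ux.
have p0 : 0 <= \prod_(w <- vs) conorm w.
  by apply: prodr_ge0 => w _; exact: sumr_ge0.
rewrite foldr_rcons dd_basis // foldr_dd_lin => [|i]; last exact: elem_dd.
apply: le_trans (ler_norm_sum _ _ _) _.
rewrite -cats1 big_cat big_seq1 /= mulrA [leRHS]mulrC /conorm mulr_suml.
apply: ler_sum => i _; rewrite normrM ler_wpM2l //.
have [_ /(_ vs szvs x Ux)] := HC i; move=> /le_trans -> //.
by rewrite ler_wpM2r // (bigD1 i) //= lerDl sumr_ge0.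
Qed.

End Bounds.

(** * Smooth series *)

Section SmoothSeries.
Variables (R : realType) (n : nat).
Local Notation V := (pt R n).
Implicit Types (f g : V -> R) (v w x : V) (vs : seq V) (G : nat -> V -> R).

Definition ssum G : V -> R := fun x => limn (series (fun k => G k x)).

(** The hypothesis of the Weierstrass M-test, for the series and all its iterated derivatives at
    once. *)
Definition dominated G := forall vs, exists2 M : nat -> R, cvgn (series M) &
  forall k x, box x -> `|foldr dd (G k) vs x| <= M k.

Lemma dominated_foldr G vs : dominated G -> dominated (fun k => foldr dd (G k) vs).
Proof.
move=> dG vs'; have [M cM HM] := dG (vs' ++ vs); exists M => // k x xb.
by rewrite -foldr_cat HM.
Qed.

Lemma box_convex x w (s : R) : box x -> box (w + x) -> 0 <= s <= 1 -> box (s *: w + x).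
Proof.
rewrite /box /= => bx bw /andP[s0 s1].
rewrite (_ : s *: w + x = s *: (w + x) + (1 - s) *: x); last first.
  by rewrite scalerBl scale1r scalerDr -addrA [s *: x + _]addrC subrK.
apply: le_lt_trans (ler_normD _ _) _; rewrite !normrZ (ger0_norm s0) ger0_norm ?subr_ge0 //.
have [->|sn0] := eqVneq s 0; first by rewrite mul0r add0r subr0 mul1r.
have : s * `|w + x| < s * 2^-1 by rewrite ltr_pM2l // lt_neqAle eq_sym sn0.
have : (1 - s) * `|x| <= (1 - s) * 2^-1 by rewrite ler_wpM2l ?subr_ge0 // ltW.
by move=> h1 h2; apply: lt_le_trans (ltr_leD h2 h1) _; rewrite -mulrDl addrC subrK mul1r.
Qed.

Lemma dd_scale f (c : R) v x : elem f -> dd (c *: v) f x = c * dd v f x.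
Proof.
move=> ef; have df := elem_differentiable x ef.
by rewrite !ddE !deriveE // linearZ.
Qed.

Lemma is_derive_line f w x (s : R) : elem f ->
  is_derive s 1 (fun s : R => f (s *: w + x) : R) (dd w f (s *: w + x)).
Proof.
move=> ef; apply: cvg_is_derive.
have := @elem_derivable _ _ f (s *: w + x) w ef.
rewrite ddE => dl; rewrite (_ : (fun h => _) = (fun h => h^-1 *: ((f \o shift (s *: w + x)) (h *: w) - f (s *: w + x)))) //.
by apply/funext => h /=; rewrite [h%:A]mulr1 scalerDl addrA.
Qed.

(** Mean value theorem on the segment from x to w + x. With w = h v it bounds the difference
    quotients of all terms by the majorant of their derivatives. *)
Lemma elem_lipschitz f w x M : elem f -> box x -> box (w + x) ->
  (forall y, box y -> `|dd w f y| <= M) -> `|f (w + x) - f x| <= M.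
Proof.
move=> ef bx bw HM.
have [|s sI] := @MVT_segment R (fun s => f (s *: w + x)) (fun s => dd w f (s *: w + x)) 0 1 ler01
   (fun s _ => is_derive_line w x s ef).
  apply: continuous_subspaceT => s; apply/differentiable_continuous/derivable1_diffP.
  by case: (is_derive_line w x s ef).
rewrite scale1r scale0r add0r subr0 mulr1 => ->; by apply: HM; apply: box_convex.
Qed.

Lemma ssum_continuous G x : (forall k, elem (G k)) -> dominated G -> box x ->
  {for x, continuous (ssum G)}.
Proof.
move=> eG dG bx; have [M cM HM] := dG [::].
apply: (@tannery _ _ _ _ (fun k y => G k y) _ M) => // [k||k]; last exact: HM.
  exact: elem_continuous.
near=> y => k; apply: HM; near: y.
exact: (open_nbhs_nbhs (conj (@box_open R n) bx)).
Unshelve. all: by end_near. Qed.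

Lemma lim_series_quot (a b : nat -> R) c : cvgn (series a) -> cvgn (series b) ->
  limn (series (fun k => c * (a k - b k))) = c * (limn (series a) - limn (series b)).
Proof.
move=> ca cb; apply/cvg_lim => //.
rewrite (_ : series _ = (fun N => c * (series a N - series b N))).
  by apply: cvgM; [exact: cvg_cst|apply: cvgB].
by apply/funext => N; rewrite /series /= -sumrB mulr_sumr.
Qed.

Lemma ssum_cvg G x : dominated G -> box x -> cvgn (series (fun k => G k x)).
Proof.
move=> dG bx; have [M cM HM] := dG [::].
by apply: dominated_cvg cM _ => k; exact: HM.
Qed.

Lemma ssum_is_derive G x v : (forall k, elem (G k)) -> dominated G -> box x ->
  is_derive x v (ssum G) (ssum (fun k => dd v (G k)) x).
Proof.
move=> eG dG bx; have [M cM HM] := dG [:: v].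
have nb : \forall h \near (0 : R)^', box (h *: v + x).
  apply: (@cvg_within _ (nbhs (0 : R)) _); have : {for 0, continuous (fun h : R => h *: v + x)}.
    by apply: cvgD; [exact: scalel_continuous|exact: cvg_cst].
  move=> /(_ (@box R n)); apply; rewrite scale0r add0r; exact: (open_nbhs_nbhs (conj (@box_open R n) bx)).
apply: cvg_is_derive.
have T : limn (series (fun k => h^-1 * (G k (h *: v + x) - G k x))) @[h --> (0 : R)^'] -->
    ssum (fun k => dd v (G k)) x.
  apply: (@tannery _ _ (0 : R)^' _ (fun k h => h^-1 * (G k (h *: v + x) - G k x))
    (fun k => dd v (G k) x) M cM) => [k||k]; last exact: HM.
    by have := @elem_derivable _ _ (G k) x v (eG k); rewrite ddE.
  near=> h => k.
  have bh : box (h *: v + x) by near: h.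
  have h0 : h != 0 by near: h; exact: nbhs_dnbhs_neq.
  rewrite normrM normfV ler_pdivrMl ?normr_gt0 //.
  apply: elem_lipschitz => // y yb.
  by rewrite dd_scale // normrM ler_wpM2l //; exact: HM.
apply: cvg_trans T; apply: near_eq_cvg; near=> h => /=.
rewrite lim_series_quot //; apply: ssum_cvg => //.
by near: h.
Unshelve. all: by end_near. Qed.

Lemma iterD_ssum G vs x : (forall k, elem (G k)) -> dominated G -> box x ->
  Defs.iterD (ssum G) vs x = ssum (fun k => foldr dd (G k) vs) x.
Proof.
move=> eG dG; elim: vs x => //= v vs IH x bx.
rewrite (@near_eq_derive _ _ _ _ (ssum (fun k => foldr dd (G k) vs))).
  have e k : elem (foldr dd (G k) vs) by exact: elem_foldr_dd.
  by have [_ ->] := ssum_is_derive v e (dominated_foldr vs dG) bx.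
near=> y; apply: IH; near: y.
exact: (open_nbhs_nbhs (conj (@box_open R n) bx)).
Unshelve. all: by end_near. Qed.

Lemma ssum_smooth G : (forall k, elem (G k)) -> dominated G -> smooth_on (@box R n) (ssum G).
Proof.
move=> eG dG vs x bx.
have e k : elem (foldr dd (G k) vs) by exact: elem_foldr_dd.
have d := dominated_foldr vs dG.
have E : \near x, ssum (fun k => foldr dd (G k) vs) x = Defs.iterD (ssum G) vs x.
  near=> y; rewrite iterD_ssum //; near: y.
  exact: (open_nbhs_nbhs (conj (@box_open R n) bx)).
split=> [v|].
  apply: near_eq_derivable E _.
  by case: (ssum_is_derive v e d bx).
apply: cvg_trans (near_eq_cvg E) _.
by rewrite /= iterD_ssum //; exact: ssum_continuous.
Unshelve. all: by end_near. Qed.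

End SmoothSeries.

(** * Levi forms *)

Section Levi.
Variables (R : realType) (n : nat).
Local Notation V := (pt R n).
Local Notation normc := ComplexField.Normc.normc.
Implicit Types (f g A B : V -> R) (x : V) (w : 'I_n.+1 -> R[i]).

(** All vectors are tested, not only those tangent to a level set, so the condition is stable under
    sums and limits; it implies the tangential condition. *)
Definition psh_at f x := forall w, 0 <= levi f x w.

(* [H u v] stands for the second derivative along [u] and [v]. *)
Definition hess_levi (H : V -> V -> R) w : R[i] :=
  \sum_j \sum_k Complex ((H (ex R j) (ex R k) + H (ey R j) (ey R k)) / 4)
    ((H (ex R j) (ey R k) - H (ey R j) (ex R k)) / 4) * w j * conjc (w k).

Lemma levi_hess f x w (H : V -> V -> R) :
  (forall u v, Defs.iterD f [:: u; v] x = H u v) -> levi f x w = hess_levi H w.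
Proof.
by move=> fH; apply: eq_bigr => j _; apply: eq_bigr => k _; rewrite /dzdzb -!fH.
Qed.

Lemma levi_elem f x w : elem f -> levi f x w = hess_levi (fun u v => dd u (dd v f) x) w.
Proof. by move=> ef; apply: levi_hess => u v; rewrite iterD_dd. Qed.

Lemma hess_leviD (H K : V -> V -> R) w :
  hess_levi (fun u v => H u v + K u v) w = hess_levi H w + hess_levi K w.
Proof.
rewrite /hess_levi -big_split; apply: eq_bigr => j _; rewrite -big_split.
apply: eq_bigr => k _ /=; rewrite -!mulrDl; congr (_ * _ * _); apply/eqP.
by rewrite eq_complex /=; apply/andP; split; apply/eqP; field.
Qed.

Lemma psh_elemD f g x : elem f -> elem g -> psh_at f x -> psh_at g x ->
  psh_at (fun y => f y + g y) x.
Proof.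
move=> ef eg pf pg w; have := addr_ge0 (pf w) (pg w); rewrite !levi_elem //; last exact: elemD.
rewrite -hess_leviD; congr (_ <= hess_levi _ w).
apply/funext => u; apply/funext => v.
by rewrite (ddD v ef eg) (ddD u (elem_dd v ef) (elem_dd v eg)).
Qed.

Lemma hess_leviZ (c : R) (H : V -> V -> R) w :
  hess_levi (fun u v => c * H u v) w = c%:C%C * hess_levi H w.
Proof.
rewrite /hess_levi mulr_sumr; apply: eq_bigr => j _; rewrite mulr_sumr.
apply: eq_bigr => k _ /=; rewrite !mulrA; congr (_ * _ * _); apply/eqP.
by rewrite eq_complex /=; apply/andP; split; apply/eqP; field.
Qed.

Lemma hess_levi0 (H : V -> V -> R) w : (forall u v, H u v = 0) -> hess_levi H w = 0.
Proof.
move=> H0; rewrite (_ : H = (fun u v => 0 * 0)).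
  by rewrite hess_leviZ mul0r.
by apply/funext => u; apply/funext => v; rewrite H0 mul0r.
Qed.

Lemma psh_elemZ (c : R) f x : elem f -> 0 <= c -> psh_at f x -> psh_at (fun y => c * f y) x.
Proof.
move=> ef c0 pf w; have := mulr_ge0 (_ : 0 <= c%:C%C) (pf w); rewrite lecR => /(_ c0).
rewrite !levi_elem //; last exact: elemZ.
rewrite -hess_leviZ; congr (_ <= hess_levi _ w).
apply/funext => u; apply/funext => v.
by rewrite (ddZ c v ef) (ddZ c u (elem_dd v ef)).
Qed.

Lemma psh_cst (c : R) x : psh_at (fun=> c) x.
Proof.
move=> w; rewrite levi_elem; last exact: elem_cst.
by rewrite hess_levi0 // => u v; rewrite !dd_cst.
Qed.

Lemma psh_sum (I : Type) (r : seq I) (F : I -> V -> R) x :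
  (forall i, elem (F i)) -> (forall i, psh_at (F i) x) ->
  psh_at (fun y => \sum_(i <- r) F i y) x.
Proof.
move=> eF pF; elim: r => [|i r IH].
  by under eq_fun do rewrite big_nil; exact: psh_cst.
under eq_fun do rewrite big_cons.
exact: (psh_elemD (eF i) (@elem_sum _ _ _ r xpredT F (fun j _ => eF j)) (pF i) IH).
Qed.

(* [hol A B]: the function A + iB is a holomorphic polynomial. *)
Inductive hol : (V -> R) -> (V -> R) -> Prop :=
| hol_cst a b : hol (fun=> a) (fun=> b)
| hol_coord j : hol (fun x => x.1 0 j) (fun x => x.2 0 j)
| holD A B A' B' : hol A B -> hol A' B' -> hol (fun x => A x + A' x) (fun x => B x + B' x)
| holM A B A' B' : hol A B -> hol A' B' ->
    hol (fun x => A x * A' x - B x * B' x) (fun x => A x * B' x + B x * A' x).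

Lemma hol_elem A B : hol A B -> elem A /\ elem B.
Proof.
elim=> {A B} [a b|j|A B A' B' _ [eA eB] _ [eA' eB']|A B A' B' _ [eA eB] _ [eA' eB']].
- by split; exact: elem_cst.
- by split; [exact: elem_re|exact: elem_im].
- by split; exact: elemD.
- by split; [apply: elemB; exact: elemM|apply: elemD; exact: elemM].
Qed.

(** Cauchy-Riemann equations, with complex derivative P + iQ. That this lies in the class again
    allows a second application for the second derivatives. *)
Lemma hol_derive A B j : hol A B -> exists P Q, [/\ hol P Q,
  dd (ex R j) A = P, dd (ey R j) A = (fun x => - Q x), dd (ex R j) B = Q & dd (ey R j) B = P].
Proof.
elim=> {A B} [a b|k|A B A' B' hA [P [Q [hP a1 a2 b1 b2]]] hA' [P' [Q' [hP' a1' a2' b1' b2']]]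
    |A B A' B' hA [P [Q [hP a1 a2 b1 b2]]] hA' [P' [Q' [hP' a1' a2' b1' b2']]]].
- exists (fun=> 0), (fun=> 0); rewrite !dd_cst; split => //; first exact: hol_cst.
  by apply/funext => x; rewrite oppr0.
- exists (fun=> (k == j)%:R), (fun=> 0); rewrite !dd_re !dd_im.
  by split; [exact: hol_cst|..]; apply/funext => x; rewrite /= !mxE ?oppr0.
- have [eA eB] := hol_elem hA; have [eA' eB'] := hol_elem hA'.
  exists (fun x => P x + P' x), (fun x => Q x + Q' x).
  split; [exact: holD|..]; rewrite ddD // ?a1 ?a2 ?b1 ?b2 ?a1' ?a2' ?b1' ?b2' //.
  by apply/funext => x; rewrite opprD.
- have [eA eB] := hol_elem hA; have [eA' eB'] := hol_elem hA'.
  have m f g : elem f -> elem g -> elem (fun x => f x * g x) by exact: elemM.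
  exists (fun x => (P x * A' x - Q x * B' x) + (A x * P' x - B x * Q' x)),
         (fun x => (P x * B' x + Q x * A' x) + (A x * Q' x + B x * P' x)).
  by split; [by apply: holD; exact: holM|..];
    rewrite ?(ddB _ (m _ _ eA eA') (m _ _ eB eB')) ?(ddD _ (m _ _ eA eB') (m _ _ eB eA'));
    rewrite !ddM // ?a1 ?a2 ?b1 ?b2 ?a1' ?a2' ?b1' ?b2'; apply/funext => x; ring.
Qed.

Lemma hess_entry (a b c d a' b' c' d' : R) : a = a' -> b = b' -> c = c' -> d = d' ->
  Complex ((a + b) / 4) ((c - d) / 4) = Complex ((a' + b') / 4) ((c' - d') / 4).
Proof. by move=> -> -> -> ->. Qed.

Lemma dd2_sqr f u v x fu fv fuv : elem f -> dd u f = fu -> dd v f = fv -> dd u fv = fuv ->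
  dd u (dd v (fun y => f y * f y)) x = 2 * (f x * fuv x + fv x * fu x).
Proof.
move=> ef <- <- <-; have e := elem_dd v ef.
rewrite (ddM v ef ef) (ddD u (elemM ef e) (elemM ef e)) (ddM u ef e).
by move: (dd u (dd v f) x) (dd v f x) (dd u f x) => *; ring.
Qed.

Lemma dd2D f g u v x : elem f -> elem g ->
  dd u (dd v (fun y => f y + g y)) x = dd u (dd v f) x + dd u (dd v g) x.
Proof. by move=> ef eg; rewrite (ddD v ef eg) (ddD u (elem_dd v ef) (elem_dd v eg)). Qed.

(** The Levi form of |f|^2, with f = A + iB holomorphic, is the squared modulus of the sum of
    (df/dz_j) w_j. *)
Lemma psh_hol_sqr A B x : hol A B -> psh_at (fun y => A y * A y + B y * B y) x.
Proof.
move=> hAB w; have [eA eB] := hol_elem hAB.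
have H j := hol_derive j hAB.
have [P {}H] := choice H; have [Q {}H] := choice H.
pose c j := Complex (P j x) (Q j x).
rewrite (_ : levi _ x w = (\sum_j c j * w j) * conjc (\sum_j c j * w j)).
  by rewrite -sqr_normc exprn_ge0.
rewrite levi_elem; last by apply: elemD; exact: elemM.
rewrite rmorph_sum mulr_suml; apply: eq_bigr => j _.
rewrite mulr_sumr; apply: eq_bigr => k _.
rewrite (_ : c j * w j * conjc (c k * w k) = c j * conjc (c k) * w j * conjc (w k)); last first.
  by rewrite rmorphM /=; ring.
congr (_ * _ * _); rewrite {}/c.
have [hP a1 a2 b1 b2] := H k; have [_ a1' a2' b1' b2'] := H j.
have [P2 [Q2 [_ c1 c2 d1 d2]]] := hol_derive j hP.
have [eP eQ] := hol_elem hP.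
have D u v := dd2D u v x (elemM eA eA) (elemM eB eB).
have n1 := etrans (ddN (ex R j) eQ) (congr1 (fun h y => - h y) d1).
have n2 := etrans (ddN (ey R j) eQ) (congr1 (fun h y => - h y) d2).
have E := hess_entry
  (etrans (D _ _) (congr2 +%R (dd2_sqr x eA a1' a1 c1) (dd2_sqr x eB b1' b1 d1)))
  (etrans (D _ _) (congr2 +%R (dd2_sqr x eA a2' a2 n2) (dd2_sqr x eB b2' b2 c2)))
  (etrans (D _ _) (congr2 +%R (dd2_sqr x eA a1' a2 n1) (dd2_sqr x eB b1' b2 c1)))
  (etrans (D _ _) (congr2 +%R (dd2_sqr x eA a2' a1 c2) (dd2_sqr x eB b2' b1 d2))).
apply: etrans E _.
by apply/eqP; rewrite eq_complex /=; apply/andP; split; apply/eqP; field.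
Qed.

Lemma psh_hol_re A B x : hol A B -> psh_at A x.
Proof.
move=> hAB w; have [eA eB] := hol_elem hAB.
rewrite levi_elem // /hess_levi big1 // => j _; rewrite big1 // => k _.
have [P [Q [hP a1 a2 b1 b2]]] := hol_derive k hAB.
have [P2 [Q2 [_ c1 c2 d1 d2]]] := hol_derive j hP.
have [eP eQ] := hol_elem hP.
have n1 := etrans (ddN (ex R j) eQ) (congr1 (fun h y => - h y) d1).
have n2 := etrans (ddN (ey R j) eQ) (congr1 (fun h y => - h y) d2).
have D u v g h : dd v A = g -> dd u g = h -> dd u (dd v A) x = h x by move=> -> ->.
rewrite (hess_entry (D _ _ _ _ a1 c1) (D _ _ _ _ a2 n2) (D _ _ _ _ a2 n1) (D _ _ _ _ a1 c2)).
by rewrite /= !subrr !mul0r.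
Qed.

(* The hypotheses say that [f] depends on z_j only. *)
Lemma psh_one_var f j x : elem f -> (forall k, k != j -> dd (ex R k) f = (fun=> 0)) ->
  (forall k, k != j -> dd (ey R k) f = (fun=> 0)) ->
  0 <= dd (ex R j) (dd (ex R j) f) x + dd (ey R j) (dd (ey R j) f) x -> psh_at f x.
Proof.
move=> ef fx fy L w.
have D u v : dd v f = (fun=> 0) -> dd u (dd v f) x = 0 by move=> ->; rewrite dd_cst.
have D' u v : dd u f = (fun=> 0) -> dd u (dd v f) x = 0 by rewrite ddC //; exact: D.
have Z (a b c d : R) z z' : a = 0 -> b = 0 -> c = 0 -> d = 0 ->
    Complex ((a + b) / 4) ((c - d) / 4) * z * z' = 0.
  by move=> -> -> -> ->; rewrite addr0 subr0 !mul0r.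
rewrite levi_elem // /hess_levi (bigD1 j) //= [X in _ + X]big1 ?addr0; last first.
  by move=> k kj; rewrite big1 // => l _; apply: Z; apply: D'; [exact: fx|exact: fy|exact: fx|exact: fy].
rewrite (bigD1 j) //= [X in _ + X]big1 ?addr0; last first.
  by move=> k kj; apply: Z; apply: D; [exact: fx|exact: fy|exact: fy|exact: fx].
(* Symmetry of second derivatives kills the imaginary part of the only surviving entry, which is
   then a quarter of the Laplacian in z_j. *)
have := congr1 (@^~ x) (ddC (ex R j) (ey R j) ef) => /= ->.
rewrite subrr mul0r -mulrA -sqr_normc mulr_ge0 ?exprn_ge0 //.
by rewrite lecE /= eqxx /= divr_ge0.
Qed.

(** The Levi forms of the partial sums converge, being linear in finitely many second derivatives,
    and being real and nonnegative is a closed condition. *)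
Lemma psh_ssum (G : nat -> V -> R) x : (forall k, elem (G k)) -> dominated G -> box x ->
  (forall k, psh_at (G k) x) -> psh_at (ssum G) x.
Proof.
move=> eG dG bx pG w.
pose H N u v := series (fun k => dd u (dd v (G k)) x) N.
pose L u v := ssum (fun k => dd u (dd v (G k))) x.
have HL u v : H N u v @[N --> \oo] --> L u v.
  exact: (ssum_cvg (dominated_foldr [:: u; v] dG) bx).
rewrite (@levi_hess _ _ _ L); last by move=> u v; rewrite iterD_ssum.
have pH N : 0 <= hess_levi (H N) w.
  elim: N => [|N IH].
    by rewrite hess_levi0 // => u v; rewrite /H /series /= big_geq.
  rewrite (_ : H N.+1 = (fun u v => H N u v + dd u (dd v (G N)) x)).
    by rewrite hess_leviD addr_ge0 // -levi_elem //; exact: pG.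
  by apply/funext => u; apply/funext => v; rewrite /H /series /= big_nat_recr.
have reE (K : V -> V -> R) : complex.Re (hess_levi K w) = \sum_j \sum_k
   ((K (ex R j) (ex R k) + K (ey R j) (ey R k)) / 4 * complex.Re (w j * conjc (w k))
   - (K (ex R j) (ey R k) - K (ey R j) (ex R k)) / 4 * complex.Im (w j * conjc (w k))).
  rewrite raddf_sum; apply: eq_bigr => j _; rewrite raddf_sum; apply: eq_bigr => k _.
  by rewrite -mulrA; case: (w j * _) => a b.
have imE (K : V -> V -> R) : complex.Im (hess_levi K w) = \sum_j \sum_k
   ((K (ex R j) (ex R k) + K (ey R j) (ey R k)) / 4 * complex.Im (w j * conjc (w k))
   + (K (ex R j) (ey R k) - K (ey R j) (ex R k)) / 4 * complex.Re (w j * conjc (w k))).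
  rewrite raddf_sum; apply: eq_bigr => j _; rewrite raddf_sum; apply: eq_bigr => k _.
  by rewrite -mulrA; case: (w j * _) => a b.
have c2 (a b c d : V) (s t : R) : ((H N a b + H N c d) / 4 * s + (H N a d - H N c b) / 4 * t) @[N --> \oo] -->
   (L a b + L c d) / 4 * s + (L a d - L c b) / 4 * t.
  apply: cvgD; (apply: cvgM; [apply: cvgM|exact: cvg_cst]); try exact: cvg_cst.
    by apply: cvgD.
  by apply: cvgB.
have cre : complex.Re (hess_levi (H N) w) @[N --> \oo] --> complex.Re (hess_levi L w).
  under eq_fun do rewrite reE; rewrite reE.
  apply: cvg_big => [|j _]; first exact: add_continuous.
  apply: cvg_big => [|k _]; first exact: add_continuous.
  by under eq_fun do rewrite -mulrN; rewrite -mulrN; exact: c2.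
have cim : complex.Im (hess_levi (H N) w) @[N --> \oo] --> complex.Im (hess_levi L w).
  under eq_fun do rewrite imE; rewrite imE.
  apply: cvg_big => [|j _]; first exact: add_continuous.
  apply: cvg_big => [|k _]; first exact: add_continuous.
  exact: c2.
have pH' N : complex.Im (hess_levi (H N) w) = 0 /\ 0 <= complex.Re (hess_levi (H N) w).
  by have := pH N; rewrite lecE /= => /andP[/eqP].
rewrite lecE /=; apply/andP; split.
  apply/eqP/(cvg_unique _ cim) => //.
  rewrite (_ : (fun N => _) = (fun=> 0)); first exact: cvg_cst.
  by apply/funext => N; case: (pH' N).
rewrite -(cvg_lim _ cre) //; apply: limr_ge; first exact: cvgP cre.
by apply: nearW => N; exact: (pH' N).2.
Qed.

End Levi.

(** * The potential *)

Section Normc.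
Variable R : realType.
Local Notation normc := ComplexField.Normc.normc.
Implicit Types (z : R[i]).

Lemma normc_sqrt z : normc z = Num.sqrt (complex.Re z ^+ 2 + complex.Im z ^+ 2).
Proof. by case: z. Qed.

Lemma normc_ge0 z : 0 <= normc z.
Proof. by rewrite normc_sqrt sqrtr_ge0. Qed.

Lemma sqr_normcE z : normc z ^+ 2 = complex.Re z ^+ 2 + complex.Im z ^+ 2.
Proof. by rewrite normc_sqrt sqr_sqrtr // addr_ge0 ?sqr_ge0. Qed.

Lemma Re_le_normc z : `|complex.Re z| <= normc z.
Proof. by rewrite normc_sqrt -sqrtr_sqr ler_wsqrtr // lerDl sqr_ge0. Qed.

Lemma Im_le_normc z : `|complex.Im z| <= normc z.
Proof. by rewrite normc_sqrt -sqrtr_sqr ler_wsqrtr // lerDr sqr_ge0. Qed.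

Lemma normcX z m : normc (z ^+ m) = normc z ^+ m.
Proof.
elim: m => [|m IH]; first by rewrite !expr0 ComplexField.Normc.normc1.
by rewrite !exprS ComplexField.Normc.normcM IH.
Qed.

Lemma normc_real (a : R) : normc a%:C%C = `|a|.
Proof. by rewrite normc_sqrt /= expr0n addr0 sqrtr_sqr. Qed.

Lemma normc_sum (I : Type) (r : seq I) (P : pred I) (F : I -> R[i]) :
  normc (\sum_(i <- r | P i) F i) <= \sum_(i <- r | P i) normc (F i).
Proof.
elim/big_ind2: _ => [|x a y b xa yb|i _] //; first by rewrite ComplexField.Normc.normc0.
by apply: le_trans (le_normcD _ _) _; rewrite lerD.
Qed.

End Normc.

(** * The smoothed pole and the flat corrector *)

Section Kernel.
Variables (R : realType) (n : nat) (i : 'I_n.+1).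
Local Notation V := (pt R n).
Local Notation normc := ComplexField.Normc.normc.
Implicit Types (x : V) (v : V) (a b c : R).

Definition dist2 a x : R := (a - x.1 0 i) * (a - x.1 0 i) + x.2 0 i * x.2 0 i.

Lemma dist2_ge0 a x : 0 <= dist2 a x.
Proof. by rewrite /dist2 -!expr2 addr_ge0 ?sqr_ge0. Qed.

(** The squared distance to the pole a, made positive everywhere by a bump supported in the disc of
    radius a/2 about a. Outside that disc [kern] is exactly Re(1/(a - z) - 1/a); the constant makes
    it vanish at z = 0. *)
Definition den a x : R := dist2 a x + flat 0 (a ^+ 2 / 4 - dist2 a x).
Definition kern a x : R := (a - x.1 0 i) * (den a x)^-1 - a^-1.
Definition bowl x : R := flat 0 (dist2 0 x).

Lemma elem_dist2 a : elem (dist2 a).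
Proof.
have e : elem (fun x : V => a - x.1 0 i) by apply: elemB; [exact: elem_cst|exact: elem_re].
by apply: elemD; apply: elemM => //; exact: elem_im.
Qed.

Lemma elem_den a : elem (den a).
Proof.
apply: elemD; first exact: elem_dist2.
by apply: elem_flat; apply: elemB; [exact: elem_cst|exact: elem_dist2].
Qed.

Lemma den_neq0 a x : 0 < a -> den a x != 0.
Proof.
move=> a0; rewrite gt_eqF // /den; have := dist2_ge0 a x.
rewrite le_eqVlt => /predU1P[<-|d0]; last by rewrite ltr_wpDr ?flat_ge0.
have c0 : 0 < a ^+ 2 / 4 by rewrite divr_gt0 ?exprn_gt0.
by rewrite add0r subr0 /flat c0 expr0 invr1 mul1r expR_gt0.
Qed.

Lemma elem_kern a : 0 < a -> elem (kern a).
Proof.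
move=> a0; apply: elemB; last exact: elem_cst.
apply: elemM; first by apply: elemB; [exact: elem_cst|exact: elem_re].
by apply: elemV; [exact: elem_den|move=> x; exact: den_neq0].
Qed.

Lemma elem_bowl : elem bowl.
Proof. by apply: elem_flat; exact: elem_dist2. Qed.

Definition ddist2 a v x : R := 2 * (x.2 0 i * v.2 0 i - (a - x.1 0 i) * v.1 0 i).

Lemma dd_arg a v : dd v (fun x => a - x.1 0 i) = (fun=> - v.1 0 i).
Proof.
rewrite (ddB v (elem_cst a) (elem_re i)) dd_cst dd_re.
by apply/funext => x; rewrite sub0r.
Qed.

Lemma dd_dist2 a v : dd v (dist2 a) = ddist2 a v.
Proof.
have e : elem (fun x : V => a - x.1 0 i) by apply: elemB; [exact: elem_cst|exact: elem_re].
have e' := @elem_im R n i.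
rewrite /dist2 (ddD v (elemM e e) (elemM e' e')) (ddM v e e) (ddM v e' e') dd_arg dd_im.
by apply/funext => x; rewrite /ddist2; ring.
Qed.

Lemma elem_ddist2 a v : elem (ddist2 a v).
Proof. by rewrite -dd_dist2; apply: elem_dd; exact: elem_dist2. Qed.

Lemma dd_ddist2 a v : dd v (ddist2 a v) = (fun=> 2 * (v.1 0 i ^+ 2 + v.2 0 i ^+ 2)).
Proof.
have e : elem (fun x : V => a - x.1 0 i) by apply: elemB; [exact: elem_cst|exact: elem_re].
have e' := @elem_im R n i.
have k b : elem (fun _ : V => b) by exact: elem_cst.
rewrite /ddist2 (ddZ 2 v (elemB (elemM e' (k _)) (elemM e (k _)))).
rewrite (ddB v (elemM e' (k _)) (elemM e (k _))) (ddM v e' (k _)) (ddM v e (k _)).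
by rewrite dd_arg dd_im !dd_cst; apply/funext => x; ring.
Qed.

Definition dden a v x : R := ddist2 a v x + flat 2 (a ^+ 2 / 4 - dist2 a x) * (- ddist2 a v x).

Lemma dd_cap a v : dd v (fun x => a ^+ 2 / 4 - dist2 a x) = (fun x => - ddist2 a v x).
Proof.
rewrite (ddB v (elem_cst _) (elem_dist2 a)) dd_cst dd_dist2.
by apply/funext => x; rewrite sub0r.
Qed.

Lemma elem_cap a : elem (fun x => a ^+ 2 / 4 - dist2 a x).
Proof. by apply: elemB; [exact: elem_cst|exact: elem_dist2]. Qed.

Lemma dd_den a v : dd v (den a) = dden a v.
Proof.
rewrite /den (ddD v (elem_dist2 a) (elem_flat 0 (elem_cap a))) dd_dist2.
rewrite (dd_flat 0 v (elem_cap a)) dd_cap; apply/funext => x.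
by rewrite /dden mul0r subr0.
Qed.

Lemma elem_dden a v : elem (dden a v).
Proof. by rewrite -dd_den; apply: elem_dd; exact: elem_den. Qed.

(** The boundary circle is included, because every [flat] factor vanishes there too. *)
Lemma dd_dden a v x : a ^+ 2 / 4 <= dist2 a x ->
  dd v (dden a v) x = 2 * (v.1 0 i ^+ 2 + v.2 0 i ^+ 2).
Proof.
rewrite -subr_le0 => le0.
have e1 := elem_flat 2 (elem_cap a); have e2 := elemN (elem_ddist2 a v).
rewrite /dden (ddD v (elem_ddist2 a v) (elemM e1 e2)) dd_ddist2 (ddM v e1 e2).
by rewrite (dd_flat 2 v (elem_cap a)) !flat_le0 // mulr0 subr0 !mul0r mulr0 !addr0.
Qed.

Lemma dd_kern a v : 0 < a -> dd v (kern a) =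
  (fun x => (a - x.1 0 i) * (- ((den a x)^-1 * (den a x)^-1) * dden a v x)
            + (den a x)^-1 * - v.1 0 i).
Proof.
move=> a0.
have e : elem (fun x : V => a - x.1 0 i) by apply: elemB; [exact: elem_cst|exact: elem_re].
have d0 x : den a x != 0 by exact: den_neq0.
have eV := elemV (elem_den a) d0.
rewrite /kern (ddB v (elemM e eV) (elem_cst _)) dd_cst (ddM v e eV) (ddV v (elem_den a) d0).
by rewrite dd_den dd_arg; apply/funext => x; rewrite subr0.
Qed.

Lemma dd2_kern a v x : 0 < a -> a ^+ 2 / 4 <= dist2 a x ->
  dd v (dd v (kern a)) x =
  2 * v.1 0 i * ddist2 a v x / dist2 a x ^+ 2 +
  (a - x.1 0 i) * (2 * ddist2 a v x ^+ 2 / dist2 a x ^+ 3 -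
   2 * (v.1 0 i ^+ 2 + v.2 0 i ^+ 2) / dist2 a x ^+ 2).
Proof.
move=> a0 far.
have e : elem (fun x : V => a - x.1 0 i) by apply: elemB; [exact: elem_cst|exact: elem_re].
have d0 y : den a y != 0 by exact: den_neq0.
have eV := elemV (elem_den a) d0.
have eVV := elemN (elemM eV eV).
have eT := elemM eVV (elem_dden a v).
rewrite (dd_kern v a0) (ddD v (elemM e eT) (elemM eV (elem_cst (- v.1 0 i)))).
rewrite (ddM v e eT) (ddM v eVV (elem_dden a v)) (ddN v (elemM eV eV)) (ddM v eV eV).
rewrite (ddM v eV (elem_cst (- v.1 0 i))) dd_cst (ddV v (elem_den a) d0) dd_den dd_arg (dd_dden _ far).
have capE : flat 2 (a ^+ 2 / 4 - dist2 a x) = 0 by rewrite flat_le0 // subr_le0.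
have -> : dden a v x = ddist2 a v x by rewrite /dden capE mul0r addr0.
have denE : den a x = dist2 a x by rewrite /den flat_le0 ?subr_le0 // addr0.
rewrite denE; have := d0 x; rewrite denE.
by move: (dist2 a x) (ddist2 a v x) (x.1 0 i) (v.1 0 i) (v.2 0 i) => S Sv X p q S0; field.
Qed.

Lemma lap_kern a x : 0 < a -> a ^+ 2 / 4 <= dist2 a x ->
  dd (ex R i) (dd (ex R i) (kern a)) x + dd (ey R i) (dd (ey R i) (kern a)) x = 0.
Proof.
move=> a0 far; rewrite !dd2_kern // /ddist2 /= !mxE eqxx.
have := den_neq0 x a0; rewrite /den flat_le0 ?subr_le0 // addr0 /dist2.
move: (x.1 0 i) (x.2 0 i) => X Y S0.
by field; exact: S0.
Qed.

Lemma mul_flatS k (s : R) : s * flat k.+1 s = flat k s.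
Proof.
rewrite /flat; case: ifP => s0; last by rewrite mulr0.
by rewrite mulrA exprS invfM mulrA divff ?mul1r // gt_eqF.
Qed.

(** For a function f of s = |z|^2 the Laplacian is 4(s f'' + f'). Here f' is [flat 2], f'' is
    [flat 4] minus twice [flat 3], and s lowers the index by one. *)
Lemma lap_bowl x : dd (ex R i) (dd (ex R i) bowl) x + dd (ey R i) (dd (ey R i) bowl) x =
  4 * (1 - dist2 0 x) * flat 3 (dist2 0 x).
Proof.
have H v : dd v (dd v bowl) x = (flat 4 (dist2 0 x) - 2 * flat 3 (dist2 0 x)) * ddist2 0 v x ^+ 2
    + flat 2 (dist2 0 x) * (2 * (v.1 0 i ^+ 2 + v.2 0 i ^+ 2)).
  rewrite (dd_flat 0 v (elem_dist2 0)) dd_dist2.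
  under eq_fun do rewrite mul0r subr0.
  have ef := elem_flat 2 (elem_dist2 0).
  rewrite (ddM v ef (elem_ddist2 0 v)) dd_ddist2 (dd_flat 2 v (elem_dist2 0)) dd_dist2.
  by rewrite addrC; congr (_ + _); ring.
(* Everything becomes a multiple of [flat 4], which leaves a polynomial identity. *)
rewrite !H -!(mul_flatS 2) -!(mul_flatS 3) /ddist2 /= !mxE eqxx mulr1n.
rewrite /dist2; move: (x.1 0 i) (x.2 0 i) (flat _ _) => X Y f; ring.
Qed.

End Kernel.

(** * Subharmonicity and Taylor expansion of a single summand *)

Section KernelBounds.
Variables (R : realType) (n : nat) (i : 'I_n.+1).
Local Notation V := (pt R n).
Local Notation normc := ComplexField.Normc.normc.
Implicit Types (x : V) (v : V) (a b c : R).

Lemma coord_le_norm (m : nat) (M : 'rV[R]_m) j : `|M 0 j| <= `|M|.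
Proof.
rewrite [leRHS]mx_normrE.
by have := @le_bigmax _ R _ 0 (fun ij : 'I_1 * 'I_m => `|M ij.1 ij.2|) (0, j).
Qed.

Lemma box_coord x j : box x -> `|x.1 0 j| < 2^-1 /\ `|x.2 0 j| < 2^-1.
Proof.
rewrite /box /= prod_normE gt_max => /andP[h1 h2].
by split; apply: le_lt_trans (coord_le_norm _ _) _.
Qed.

Lemma dist2_lt_half x : box x -> dist2 i 0 x < 2^-1.
Proof.
move=> /(@box_coord _ i) [h1 h2].
rewrite /dist2 sub0r mulrNN -!expr2 -(real_normK (num_real (x.1 0 i))) -(real_normK (num_real (x.2 0 i))).
have : `|x.1 0 i| ^+ 2 < 2^-1 ^+ 2 by rewrite ltrXn2r // nnegrE.
have : `|x.2 0 i| ^+ 2 < 2^-1 ^+ 2 by rewrite ltrXn2r // nnegrE.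
by rewrite expr2; lra.
Qed.

Lemma dd_kern0 a v : 0 < a -> v.1 0 i = 0 -> v.2 0 i = 0 -> dd v (kern i a) = (fun=> 0).
Proof.
move=> a0 v1 v2; rewrite dd_kern //; apply/funext => x.
by rewrite /dden /ddist2 v1 v2; ring.
Qed.

Lemma dd_bowl0 v : v.1 0 i = 0 -> v.2 0 i = 0 -> dd v (@bowl R n i) = (fun=> 0).
Proof.
move=> v1 v2; rewrite (dd_flat 0 v (elem_dist2 i 0)) dd_dist2; apply/funext => x.
by rewrite /ddist2 v1 v2; ring.
Qed.

Definition piece a (C : R) x : R := kern i a x + C * bowl i x.

Lemma elem_piece a C : 0 < a -> elem (piece a C).
Proof. by move=> a0; apply: elemD; [exact: elem_kern|apply: elemZ; exact: elem_bowl]. Qed.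

Lemma dd_piece a C v : 0 < a -> dd v (piece a C) = (fun x => dd v (kern i a) x + C * dd v (@bowl R n i) x).
Proof.
move=> a0; rewrite /piece (ddD v (elem_kern i a0) (elemZ C (@elem_bowl _ _ i))).
by rewrite (ddZ C v (@elem_bowl _ _ i)).
Qed.

Lemma dd2_piece a C v x : 0 < a ->
  dd v (dd v (piece a C)) x = dd v (dd v (kern i a)) x + C * dd v (dd v (@bowl R n i)) x.
Proof.
move=> a0; rewrite dd_piece //.
have e1 := elem_dd v (elem_kern i a0); have e2 := elem_dd v (@elem_bowl R n i).
by rewrite (ddD v e1 (elemZ C e2)) (ddZ C v e2).
Qed.

Lemma dd_piece0 a C v : 0 < a -> v.1 0 i = 0 -> v.2 0 i = 0 -> dd v (piece a C) = (fun=> 0).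
Proof.
move=> a0 v1 v2; rewrite dd_piece // dd_kern0 // dd_bowl0 //.
by apply/funext => x; rewrite mulr0 addr0.
Qed.

Lemma flat3_ge (c s : R) : 0 < c -> c <= s -> s <= 1 -> expR (- c^-1) <= flat 3 s.
Proof.
move=> c0 cs s1; have s0 := lt_le_trans c0 cs.
rewrite /flat s0; apply: (@le_trans _ _ (expR (- s^-1))).
  by rewrite ler_expR lerN2 lef_pV2.
by rewrite ler_peMl ?expR_ge0 // invf_ge1 ?exprn_gt0 // exprn_ile1 // ltW.
Qed.

(* The Laplacian of [kern] is nonzero only away from 0, where that of [bowl] is bounded below. *)
Lemma piece_psh a : 0 < a -> exists C, forall x, box x -> psh_at (piece a C) x.
Proof.
move=> a0.
pose L x := dd (ex R i) (dd (ex R i) (kern i a)) x + dd (ey R i) (dd (ey R i) (kern i a)) x.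
have eL : elem L by apply: elemD; do 2 apply: elem_dd; exact: elem_kern.
have [B B0 HB] := elem_bounded eL.
have c0 : 0 < a ^+ 2 / 4 by rewrite divr_gt0 ?exprn_gt0.
(* B bounds the Laplacian of [kern]; the exponential is the inverse of the lower bound for [flat 3]
   at distance at least a/2 from 0. *)
exists (B * expR ((a ^+ 2 / 4)^-1)) => x bx.
have delta k : k != i -> (i == k)%:R = 0 :> R by rewrite eq_sym => /negbTE ->.
apply: (psh_one_var (j := i) (elem_piece _ a0)) => [k ki|k ki|].
- by apply: dd_piece0 => //=; rewrite !mxE ?delta.
- by apply: dd_piece0 => //=; rewrite !mxE ?delta.
rewrite !dd2_piece // addrACA -mulrDr lap_bowl -/(L x).
have T := dist2_lt_half bx.
have [far|near] := leP (a ^+ 2 / 4) (dist2 i a x).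
  rewrite /L lap_kern // add0r mulr_ge0 ?mulr_ge0 ?expR_ge0 ?flat_ge0 ?subr_ge0 //.
  by apply: ltW; apply: lt_trans T _; rewrite invf_lt1 ?ltr1n.
(* A point within a/2 of the pole has real part above a/2, so it stays away from 0. *)
have h : a ^+ 2 / 4 <= dist2 i 0 x.
  move: near; rewrite /dist2; move: (x.1 0 i) (x.2 0 i) => X Y.
  have [Xa|Xa] := lerP (a / 2) X; last by nra.
  by move=> _; nra.
have := HB x bx; rewrite ler_norml => /andP[+ _].
have := flat3_ge c0 h; move=> /(_ (ltW (lt_trans T _))); rewrite invf_lt1 ?ltr1n // => /(_ isT).
rewrite expRN => E0 E2.
have E1 : 1 <= expR ((a ^+ 2 / 4)^-1) * flat 3 (dist2 i 0 x) by rewrite -ler_pdivrMl ?expR_gt0 // mulr1.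
have E3 : B <= B * expR ((a ^+ 2 / 4)^-1) * flat 3 (dist2 i 0 x).
  by rewrite -mulrA ler_peMr.
move: E2 E3 T; rewrite -/(L x).
set e := expR _; set f := flat 3 _; set t := dist2 i 0 x; set l := L x => E2 E3 T.
have h1 : 0 <= l + B by lra.
have h2 : 0 <= B * e * f - B by rewrite subr_ge0.
(* The factor 4(1 - t) of the Laplacian is split as 1 + (3 - 4t), and t < 1/2: the 1 compensates B,
   the rest is nonnegative. *)
have h3 : 0 <= (B * e * f) * (3 - 4 * t).
  by apply: mulr_ge0; [rewrite !mulr_ge0 ?expR_ge0 ?flat_ge0|lra].
by rewrite (_ : l + _ = (l + B) + (B * e * f - B) + (B * e * f) * (3 - 4 * t)); [lra|ring].
Qed.

Lemma dist2_normc x : dist2 i 0 x = normc (zcoord x i) ^+ 2.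
Proof. by rewrite sqr_normcE /= /dist2 sub0r mulrNN -!expr2. Qed.

Lemma normc_box x : box x -> normc (zcoord x i) <= 1.
Proof.
move=> bx; rewrite -(@ler_pXn2r _ 2) ?nnegrE ?normc_ge0 // expr1n -dist2_normc.
by apply: ltW; apply: lt_trans (dist2_lt_half bx) _; rewrite invf_lt1 ?ltr1n.
Qed.

Lemma geom_remainder (al z : R[i]) N : al != 0 -> al - z != 0 ->
  (al - z)^-1 - al^-1 = \sum_(m < N) z ^+ m.+1 / al ^+ m.+2 + (z / al) ^+ N.+1 / (al - z).
Proof.
move=> a0 az; elim: N => [|N IH]; first by rewrite big_ord0 add0r expr1; field; rewrite a0 az.
rewrite IH big_ord_recr /= -addrA; congr (_ + _).
rewrite !expr_div_n !exprS; field.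
by rewrite a0 az expf_neq0.
Qed.

Lemma kern_far a x : 0 < a -> a ^+ 2 / 4 <= dist2 i a x ->
  kern i a x = complex.Re ((a%:C%C - zcoord x i)^-1 - a%:C%C^-1).
Proof.
move=> a0 far; rewrite /kern /den flat_le0 ?subr_le0 // addr0 raddfB /=.
congr (_ - _); first by rewrite /dist2; congr (_ / _); ring.
by rewrite expr0n addr0 expr2 invfM mulrA divff ?mul1r // gt_eqF.
Qed.

Definition taylor_term a m (z : R[i]) : R := complex.Re (z ^+ m.+1) / a ^+ m.+2.

(** For |z| <= a/2 the kernel is Re(1/(a - z) - 1/a) and the geometric series has an exact
    remainder. For |z| > a/2 all terms are bounded and (2|z|/a)^(N+1) >= 1. The corrector is smaller
    than any power of |z|. *)
Lemma piece_taylor a C N : 0 < a -> exists2 B, 0 <= B & forall x, box x ->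
  `|piece a C x - \sum_(m < N) taylor_term a m (zcoord x i)| <= B * normc (zcoord x i) ^+ N.+1.
Proof.
move=> a0.
have [K K0 HK] := flat_le R 0 N.+1.
have [M M0 HM] := elem_bounded (elem_kern i a0).
pose S := \sum_(m < N) (a ^+ m.+2)^-1 : R.
have S0 : 0 <= S by apply: sumr_ge0 => m _; rewrite invr_ge0 exprn_ge0 // ltW.
(* The summands serve, in this order, |z| <= a/2, |z| > a/2, and the corrector. *)
exists (2 / a ^+ N.+2 + (M + S) * (2 / a) ^+ N.+1 + `|C| * K) => [|x bx].
  rewrite !addr_ge0 ?mulr_ge0 ?addr_ge0 ?exprn_ge0 ?invr_ge0 ?exprn_ge0 ?divr_ge0 ?(ltW a0) //.
have b2 : 0 <= (M + S) * (2 / a) ^+ N.+1.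
  by rewrite mulr_ge0 ?addr_ge0 // exprn_ge0 // divr_ge0 // ltW.
have b1 : 0 <= 2 / a ^+ N.+2 by rewrite divr_ge0 // exprn_ge0 // ltW.
set z := zcoord x i; have z1 : normc z <= 1 by exact: normc_box.
have z0 := normc_ge0 z.
have p0 : 0 <= normc z ^+ N.+1 by rewrite exprn_ge0.
have -> : piece a C x - \sum_(m < N) taylor_term a m z =
  (kern i a x - \sum_(m < N) taylor_term a m z) + C * bowl i x by rewrite /piece; ring.
apply: le_trans (ler_normD _ _) _; rewrite [leRHS]mulrDl; apply: lerD; last first.
  rewrite normrM -mulrA ler_wpM2l // (le_trans (HK _)) // ler_wpM2l //.
  rewrite dist2_normc normrX ger0_norm // -exprM mulnC.
  by rewrite ler_wiXn2l // leq_pmulr.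
have [zs|zl] := leP (normc z) (a / 2).
  have far : a ^+ 2 / 4 <= dist2 i a x.
    have : normc z ^+ 2 <= (a / 2) ^+ 2 by rewrite lerXn2r // nnegrE divr_ge0 // ltW.
    rewrite -dist2_normc /dist2; move: (x.1 0 i) (x.2 0 i) => X Y.
    move=> H; have [Xa|Xa] := lerP X (a / 2); last by nra.
    by nra.
  have aC : a%:C%C != 0 :> R[i] by rewrite eq_complex /= eqxx andbT gt_eqF.
  have lb : a / 2 <= normc (a%:C%C - z).
    have := le_normcD (a%:C%C - z) z; rewrite subrK normc_real gtr0_norm //.
    by move: zs; lra.
  have azp : 0 < normc (a%:C%C - z) by apply: lt_le_trans lb; rewrite divr_gt0.
  have az : a%:C%C - z != 0.
    by apply: contraTneq azp => ->; rewrite ComplexField.Normc.normc0 ltxx.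
  rewrite kern_far // (geom_remainder N aC az) raddfD raddf_sum /=.
  have -> : \sum_(m < N) complex.Re (z ^+ m.+1 / a%:C%C ^+ m.+2) = \sum_(m < N) taylor_term a m z.
    apply: eq_bigr => m _; rewrite /taylor_term -rmorphXn -fmorphV /=.
    by case: (z ^+ m.+1) => u v /=; rewrite mulr0 subr0.
  rewrite addrAC subrr add0r (le_trans (Re_le_normc _)) //.
  rewrite ComplexField.Normc.normcM ComplexField.Normc.normcV normcX ComplexField.Normc.normcM.
  rewrite ComplexField.Normc.normcV normc_real gtr0_norm // expr_div_n.
  apply: (@le_trans _ _ (2 / a ^+ N.+2 * normc z ^+ N.+1)); last first.
    by rewrite ler_wpM2r // lerDl.
  rewrite -[leLHS]mulrA [leRHS]mulrC; apply: ler_wpM2l => //.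
  rewrite [a ^+ N.+2]exprS invfM mulrA [leRHS]mulrC ler_wpM2l ?invr_ge0 ?exprn_ge0 ?(ltW a0) //.
  by rewrite -[2 / a]invf_div lef_pV2 // posrE divr_gt0.
apply: (@le_trans _ _ ((M + S) * (2 / a) ^+ N.+1 * normc z ^+ N.+1)); last first.
  by rewrite ler_wpM2r // lerDr.
apply: (@le_trans _ _ (M + S)); last first.
  rewrite -mulrA -exprMn ler_peMr ?addr_ge0 //; apply: exprn_ege1; rewrite mulrAC ler_pdivlMr // mul1r mulrC -ler_pdivrMr //.
  by rewrite ltW.
apply: le_trans (ler_normB _ _) _; apply: lerD; first exact: HM.
apply: le_trans (ler_norm_sum _ _ _) _; apply: ler_sum => m _.
rewrite /taylor_term normrM normfV (ger0_norm (exprn_ge0 _ (ltW a0))).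
rewrite ler_piMl ?invr_ge0 ?exprn_ge0 ?(ltW a0) // (le_trans (Re_le_normc _)) //.
by rewrite normcX exprn_ile1.
Qed.

End KernelBounds.

(** * Summation over the poles *)

Section Potential.
Variables (R : realType) (n : nat) (i : 'I_n.+1).
Local Notation V := (pt R n).
Local Notation normc := ComplexField.Normc.normc.

Lemma foldr_ddZ (c : R) (f : V -> R) vs : elem f ->
  foldr dd (fun x => c * f x) vs = (fun x => c * foldr dd f vs x).
Proof. by move=> ef; elim: vs => //= v vs ->; rewrite ddZ //; exact: elem_foldr_dd. Qed.

Lemma weighted_dominated (F : nat -> V -> R) (c : nat -> nat -> R) (eps : nat -> R) :
  (forall k, elem (F k)) -> (forall k, 0 < eps k) ->
  (forall k m vs, size vs = m -> forall x : V, box x ->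
    `|foldr dd (F k) vs x| <= c k m * \prod_(v <- vs) conorm v) ->
  (forall m, exists A, forall k, eps k * c k m <= A * 2^-1 ^+ k) ->
  dominated (fun k x => eps k * F k x).
Proof.
move=> eF e0 HF He vs; have [A HA] := He (size vs).
pose P := \prod_(v <- vs) @conorm R n v.
have P0 : 0 <= P by apply: prodr_ge0 => v _; exact: sumr_ge0.
exists (fun k => (A * P) * 2^-1 ^+ k) => [|k x bx]; first exact: summable_half.
rewrite foldr_ddZ // normrM (gtr0_norm (e0 k)).
apply: le_trans (ler_wpM2l (ltW (e0 k)) (HF k (size vs) vs erefl x bx)) _.
by rewrite mulrA [leRHS]mulrAC ler_wpM2r.
Qed.

Lemma sum_half (A : R) : limn (series (fun k => A * 2^-1 ^+ k)) = 2 * A.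
Proof.
have h : `|2^-1 : R| < 1 by rewrite ger0_norm ?invf_lt1 ?ltr1n.
have := cvg_lim (@Rhausdorff R) (cvg_geometric_series (a := A) h).
by move=> ->; field.
Qed.

(** Fix k with k + 1 >= 2(|L| + 1). Then h m is at least e_k 2^(m+1) (|L| + 1)^(m+1), and e_k
    2^(m+1) exceeds |M| for some m, however small e_k is. *)
Lemma superexponential (e : nat -> R) (h : nat -> R) : (forall k, 0 < e k) ->
  (forall k m, e k * k.+1%:R ^+ m.+2 <= h m) -> forall L M, exists m, M * L ^+ m.+1 < h m.
Proof.
move=> e0 eh L M.
pose L' := `|L| + 1.
have L'0 : 0 < L' by rewrite ltr_wpDl.
pose k := Num.bound (2 * L').
have kL : 2 * L' <= k.+1%:R.
  apply: ltW; apply: lt_le_trans (archi_boundP _) _; first by rewrite mulr_ge0 // ltW.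
  by rewrite ler_nat.
have [m mM] : exists m, `|M| < e k * 2 ^+ m.+1.
  exists (Num.bound (`|M| / e k)); rewrite mulrC -ltr_pdivrMr //.
  apply: lt_le_trans (archi_boundP _) _; first by rewrite divr_ge0 // ltW.
  by rewrite -natrX ler_nat ltnW // (leq_trans (ltn_expl _ (ltnSn 1))) // leq_exp2l.
exists m; apply: lt_le_trans (eh k m).
apply: (@le_lt_trans _ _ (`|M| * L' ^+ m.+1)).
  apply: le_trans (ler_norm _) _; rewrite normrM normrX ler_wpM2l // lerXn2r ?nnegrE //; last first.
    by rewrite lerDl.
  exact: ltW.
apply: (@lt_le_trans _ _ (e k * (2 * L') ^+ m.+1)).
  by rewrite exprMn mulrA ltr_pM2r ?exprn_gt0.
rewrite ler_wpM2l ?(ltW (e0 k)) //.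
apply: (@le_trans _ _ (k.+1%:R ^+ m.+1)).
  by rewrite lerXn2r ?nnegrE // mulr_ge0 // ltW.
by rewrite [leRHS]exprS ler_peMl ?exprn_ge0 // ler1n.
Qed.

Lemma choice2 (S T U : Type) (Q : S -> T -> U -> Prop) :
  (forall s t, exists u, Q s t u) -> exists f : S -> T -> U, forall s t, Q s t (f s t).
Proof.
move=> H; have [f Hf] := choice (fun p : S * T => H p.1 p.2).
by exists (fun s t => f (s, t)) => s t; exact: (Hf (s, t)).
Qed.

Lemma exists_potential : exists (F : nat -> V -> R) (h : nat -> R),
  [/\ forall k, elem (F k), dominated F, forall k (x : V), box x -> psh_at (F k) x,
      forall k (v : V), v.1 0 i = 0 -> v.2 0 i = 0 -> dd v (F k) = (fun=> 0)
    & (forall N, exists B, forall x : V, box x ->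
        `|ssum F x - \sum_(m < N) h m * complex.Re (zcoord x i ^+ m.+1)|
          <= B * normc (zcoord x i) ^+ N.+1) /\
      (forall L M, exists m, M * L ^+ m.+1 < h m)].
Proof.
pose a k : R := k.+1%:R^-1.
have a0 k : 0 < a k by rewrite invr_gt0 ltr0n.
have [C HC] := choice (fun k => piece_psh i (a0 k)).
pose P k := piece i (a k) (C k).
have eP k : elem (P k) by exact: elem_piece.
have H1 k m : exists c : R, 0 <= c /\ forall vs, size vs = m -> forall x : V, box x ->
    `|foldr dd (P k) vs x| <= c * \prod_(v <- vs) conorm v.
  by have [c c0 Hc] := foldr_dd_bounded m (eP k); exists c.
have [c1 {}H1] := choice2 H1.
have H2 k N : exists c : R, 0 <= c /\ forall x : V, box x ->
    `|P k x - \sum_(m < N) taylor_term (a k) m (zcoord x i)| <= c * normc (zcoord x i) ^+ N.+1.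
  by have [c c0 Hc] := piece_taylor i (C k) N (a0 k); exists c.
have [c2 {}H2] := choice2 H2.
have p0 k m : 0 <= (a k ^+ m.+2)^-1 by rewrite invr_ge0 exprn_ge0 // ltW.
have c10 k m : 0 <= c1 k m by case: (H1 k m).
have c20 k m : 0 <= c2 k m by case: (H2 k m).
(* One array collects derivative bounds, Taylor remainders and Taylor coefficients, so one choice of
   weights makes all three kinds of series converge. *)
pose B k m := c1 k m + c2 k m + (a k ^+ m.+2)^-1.
have [eps e0 He] := diagonal_weights B.
have B0 k m : 0 <= B k m by rewrite !addr_ge0.
have He' (c : nat -> nat -> R) : (forall k m, c k m <= B k m) ->
    forall m, exists A, forall k, eps k * c k m <= A * 2^-1 ^+ k.
  move=> cB m; have [A HA] := He m; exists A => k; apply: le_trans (HA k).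
  by rewrite ler_wpM2l ?(ltW (e0 k)) // ger0_norm.
pose F k x := eps k * P k x.
have dF : dominated F.
  apply: (@weighted_dominated P c1 eps) => // [k m|]; first by case: (H1 k m).
  by apply: He' => k m; rewrite /B -addrA lerDl addr_ge0.
(* The contribution of pole k to the coefficient of z^(m+1); the constant term was removed in
   [kern]. *)
pose hs m k := eps k * (a k ^+ m.+2)^-1.
have hs0 m k : 0 <= hs m k by rewrite mulr_ge0 // ltW.
have hcvg m : cvgn (series (hs m)).
  have cB k m' : (a k ^+ m'.+2)^-1 <= B k m' by rewrite /B lerDr addr_ge0.
  have [A HA] := He' _ cB m; apply: (@dominated_cvg _ _ (fun k => A * 2^-1 ^+ k)) => [|k].
    exact: summable_half.
  by rewrite ger0_norm //; exact: HA.
pose h m := limn (series (hs m)).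
exists F, h; split; [by move=> k; apply: elemZ; exact: eP|exact: dF|..].
- by move=> k x bx; apply: psh_elemZ => //; [exact: ltW|exact: HC].
- move=> k v v1 v2; rewrite /F ddZ // dd_piece0 //.
  by apply/funext => x; rewrite mulr0.
split; last first.
  (* By positivity each single term is at most the whole sum [h m]. *)
  apply: (@superexponential eps) => // k m.
  have -> : eps k * k.+1%:R ^+ m.+2 = hs m k by rewrite /hs /a exprVn invrK.
  apply: le_trans (nondecreasing_cvgn_le _ (hcvg m) k.+1).
    by rewrite /series /= big_nat_recr //= lerDr sumr_ge0.
  by move=> p q pq; rewrite -subr_ge0 sub_series pq sumr_ge0.
move=> N.
have cB k m : c2 k m <= B k m by rewrite /B [c1 k m + _]addrC -addrA lerDl addr_ge0.
have [A HA] := He' _ cB N; exists (2 * A) => x bx.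
set z := zcoord x i; pose Z := normc z ^+ N.+1.
have Z0 : 0 <= Z by rewrite exprn_ge0 // normc_ge0.
pose t k := F k x - \sum_(m < N) hs m k * complex.Re (z ^+ m.+1).
have tB k : `|t k| <= (A * Z) * 2^-1 ^+ k.
  rewrite (_ : t k = eps k * (P k x - \sum_(m < N) taylor_term (a k) m z)); last first.
    rewrite mulrBr mulr_sumr; congr (_ - _); apply: eq_bigr => m _.
    by rewrite /taylor_term /hs mulrAC mulrA.
  rewrite normrM (gtr0_norm (e0 k)).
  apply: le_trans (ler_wpM2l (ltW (e0 k)) ((H2 k N).2 x bx)) _.
  by rewrite mulrA [leRHS]mulrAC ler_wpM2r.
have := dominated_sum (@summable_half R (A * Z)) tB; rewrite sum_half mulrA.
congr (`| _ | <= _); apply/cvg_lim => //.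
have cF := ssum_cvg dF bx.
rewrite (_ : series t = (fun M => series (F ^~ x) M - \sum_(m < N) series (hs m) M * complex.Re (z ^+ m.+1))).
  apply: cvgB => //; apply: cvg_big => [|m _]; first exact: add_continuous.
  by apply: cvgM; [exact: hcvg|exact: cvg_cst].
apply/funext => M; rewrite /series /= /t sumrB exchange_big /=; congr (_ - _).
by apply: eq_bigr => m _; rewrite mulr_suml.
Qed.

End Potential.

(** * Averaging over roots of unity *)

Section Averaging.
Variable R : realType.
Local Notation C := R[i].
Local Notation normc := ComplexField.Normc.normc.
Implicit Types (p : {poly C}) (t z : C).

(** Over the algebraically closed field C, X^K - 1 splits, and it is separable in characteristic 0;
    K distinct K-th roots of unity include a primitive one. *)
Lemma prim_root_exists K : (0 < K)%N -> exists z : C, K.-primitive_root z.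
Proof.
pose p : {poly C} := 'X^K - 1; have [r Dp] := closed_field_poly_normal p.
move=> K0; rewrite (monicP _) ?monicXnsubC // scale1r in Dp.
have rn1 : all K.-unity_root r by apply/allP=> z; rewrite -root_prod_XsubC -Dp.
have sz_r : (K < (size r).+1)%N by rewrite -(size_prod_XsubC r id) -Dp size_XnsubC.
have [|z] := hasP (has_prim_root K0 rn1 _ sz_r); last by exists z.
by rewrite -separable_prod_XsubC -Dp separable_Xn_sub_1 // pnatr_eq0 -lt0n.
Qed.

Lemma sum_unity_root K (w : C) m : K.-primitive_root w -> ~~ (K %| m)%N ->
  \sum_(j < K) (w ^+ j) ^+ m = 0.
Proof.
move=> pw Km; have : (w ^+ m) ^+ K - 1 = 0 by rewrite exprAC (prim_expr_order pw) expr1n subrr.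
rewrite subrX1 => /eqP; rewrite mulf_eq0 subr_eq0 -(prim_order_dvd pw) (negbTE Km) /= => /eqP E.
by rewrite -[RHS]E; apply: eq_bigr => j _; rewrite exprAC.
Qed.

Lemma normc_unity_root K (w : C) : K.-primitive_root w -> normc w = 1.
Proof.
move=> pw; have K0 := prim_order_gt0 pw.
have := congr1 (@ComplexField.Normc.normc R) (prim_expr_order pw); rewrite normcX ComplexField.Normc.normc1 => /eqP.
by rewrite pexprn_eq1 ?normc_ge0 // gtn_eqF //= => /eqP.
Qed.

(** The conjugate is the inverse; writing it as a power keeps all exponents natural numbers. *)
Lemma conj_unity_root K (w : C) : K.-primitive_root w -> conjc w = w ^+ K.-1.
Proof.
move=> pw; have K0 := prim_order_gt0 pw.
have n0 : w != 0.
  apply/eqP => w0; have := normc_unity_root pw.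
  by rewrite w0 ComplexField.Normc.normc0 => /eqP; rewrite eq_sym oner_eq0.
apply: (mulfI n0); rewrite -exprS prednK // (prim_expr_order pw) -sqr_normc.
have -> : `|w| = (normc w)%:C%C by case: (w).
by rewrite (normc_unity_root pw) expr1n.
Qed.

(* Discrete Cauchy formula. *)
Lemma coef_average K (w : C) p t l : K.-primitive_root w -> (size p <= K)%N -> (l < K)%N ->
  \sum_(j < K) (w ^+ j) ^+ (K - l) * p.[w ^+ j * t] = K%:R * p`_l * t ^+ l.
Proof.
move=> pw sp lK.
under eq_bigr => j _ do rewrite (horner_coef_wide _ sp) mulr_sumr.
rewrite exchange_big (bigD1 (Ordinal lK)) //= [X in _ + X]big1 ?addr0 => [|m ml].
  rewrite (eq_bigr (fun=> p`_l * t ^+ l)) => [|j _].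
    by rewrite sumr_const card_ord -[LHS]mulr_natl -mulrA.
  have E : (w ^+ j) ^+ (K - l) * (w ^+ j) ^+ l = 1.
    by rewrite -exprD subnK ?(ltnW lK) // exprAC (prim_expr_order pw) expr1n.
  by rewrite -[RHS]mul1r -E exprMn; ring.
have -> : \sum_(j < K) (w ^+ j) ^+ (K - l) * (p`_m * (w ^+ j * t) ^+ m) =
  (\sum_(j < K) (w ^+ j) ^+ (K - l + m)) * (p`_m * t ^+ m).
  by rewrite mulr_suml; apply: eq_bigr => j _; rewrite exprMn exprD; ring.
(* The exponent K - l + m lies strictly between 0 and 2K, so K divides it only when m = l. *)
rewrite (sum_unity_root pw) ?mul0r //; apply/negP => /dvdnP[q E].
have mK := ltn_ord m; have ml' : (m : nat) != l by apply: contra ml => /eqP e; apply/eqP/val_inj.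
case: q E => [|[|q]]; rewrite ?mul0n ?mul1n => E; [lia|lia|].
by have : (2 * K <= q.+2 * K)%N; [rewrite leq_mul2r orbT|lia].
Qed.

(** Conjugation turns degree m into frequency -m. The filter for frequency l then sees -(l + m)
    modulo K, which is not 0 because 0 < l + m < K. *)
Lemma conj_average K (w : C) p t l : K.-primitive_root w -> p`_0 = 0 -> (2 * size p <= K)%N ->
  (0 < l)%N -> (2 * l < K)%N ->
  \sum_(j < K) (w ^+ j) ^+ (K - l) * conjc p.[w ^+ j * t] = 0.
Proof.
move=> pw p0 sp l0 lK.
have K0 := prim_order_gt0 pw.
have E j : conjc p.[w ^+ j * t] = \sum_(m < size p) conjc (p`_m * t ^+ m) * (w ^+ j) ^+ (K.-1 * m).
  rewrite horner_coef rmorph_sum; apply: eq_bigr => m _.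
  rewrite exprMn mulrCA rmorphM mulrC; congr (_ * _).
  rewrite rmorphXn rmorphXn /= (conj_unity_root pw) [RHS]exprM; congr (_ ^+ m).
  exact: exprAC.
under eq_bigr => j _ do rewrite E mulr_sumr.
rewrite exchange_big big1 // => m _ /=.
have -> : \sum_(j < K) (w ^+ j) ^+ (K - l) * (conjc (p`_m * t ^+ m) * (w ^+ j) ^+ (K.-1 * m)) =
  (\sum_(j < K) (w ^+ j) ^+ (K - l + K.-1 * m)) * conjc (p`_m * t ^+ m).
  by rewrite mulr_suml; apply: eq_bigr => j _; rewrite exprD; ring.
have [m0|m0] := posnP m; first by rewrite m0 p0 mul0r rmorph0 mulr0.
rewrite (sum_unity_root pw) ?mul0r //.
have mp := ltn_ord m.
have -> : (K - l + K.-1 * m = m * K + (K - (l + m)))%N.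
  have -> : (K.-1 * m = m * K - m)%N by rewrite -subn1 mulnBl mul1n mulnC.
  have : (m <= m * K)%N by rewrite leq_pmulr.
  lia.
rewrite dvdn_addr ?dvdn_mull //; apply/negP => /dvdn_leq; lia.
Qed.

Lemma normc_ball_small (P : R) (l N : nat) (B d : R) : (l < N)%N -> 0 < d -> 0 <= P ->
  (forall s, 0 < s -> s < d -> P * s ^+ l <= B * s ^+ N) -> P = 0.
Proof.
move=> lN d0 P0 H; apply/eqP; rewrite -[_ == _]negbK; apply/negP => Pn0.
have Pp : 0 < P by rewrite lt_neqAle eq_sym Pn0.
have B1 : 0 < `|B| + 1 by rewrite ltr_wpDl.
(* Small enough that |B| s < P, which contradicts P <= B s^(N-l) at s <= 1. *)
pose s := Num.min (d / 2) (Num.min 1 (P / (`|B| + 1) / 2)).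
have s0 : 0 < s by rewrite !lt_min !divr_gt0 // ltr01.
have sd : s < d by rewrite !gt_min ltr_pdivrMr // ltr_pMr // ltr1n.
have s1 : s <= 1 by rewrite !ge_min lexx orbT.
have sP : s * (`|B| + 1) < P.
  rewrite -ltr_pdivlMr // /s !gt_min; apply/orP; right; apply/orP; right.
  by rewrite ltr_pdivrMr // ltr_pMr ?divr_gt0 // ltr1n.
have := H s s0 sd; rewrite -(subnKC lN) exprD exprS [B * _]mulrA.
move=> h; have : P * s ^+ l <= (`|B| + 1) * s * s ^+ l.
  apply: le_trans h _.
  rewrite (_ : B * _ * _ = B * (s * s ^+ (N - l.+1)) * s ^+ l); last by ring.
  rewrite ler_wpM2r ?exprn_ge0 ?(ltW s0) //.
  apply: (@le_trans _ _ (`|B| * s)); last by rewrite ler_wpM2r ?(ltW s0) // lerDl.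
  apply: (@le_trans _ _ (`|B| * (s * s ^+ (N - l.+1)))).
    by rewrite ler_wpM2r ?ler_norm // mulr_ge0 ?exprn_ge0 // ltW.
  by rewrite ler_wpM2l // ler_piMr ?exprn_ile1 // ltW.
rewrite ler_pM2r ?exprn_gt0 // mulrC => /le_lt_trans /(_ sP).
by rewrite ltxx.
Qed.

Lemma poly_small_eq0 p N (B d : R) : (size p <= N)%N -> 0 < d ->
  (forall t, normc t < d -> normc p.[t] <= B * normc t ^+ N) -> p = 0.
Proof.
move=> sp d0 H; case: N sp H => [|N] sp H.
  by apply/eqP; rewrite -size_poly_eq0 -leqn0.
have [w pw] := prim_root_exists (ltn0Sn N).
apply/polyP => l; rewrite coef0.
have [lN|/(leq_trans sp)/leq_sizeP->//] := ltnP l N.+1.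
apply: ComplexField.Normc.eq0_normc.
apply: (@normc_ball_small _ l N.+1 B d) => // [|s s0 sd]; first exact: normc_ge0.
have ns : normc s%:C%C = s by rewrite normc_real gtr0_norm.
have := congr1 (@ComplexField.Normc.normc R) (coef_average (s%:C%C) pw sp lN).
rewrite !ComplexField.Normc.normcM normcX ns.
have -> : normc (N.+1%:R : C) = N.+1%:R by rewrite -(rmorph_nat (real_complex R)) normc_real normr_nat.
move=> E; rewrite -(@ler_pM2l _ N.+1%:R) ?ltr0n // mulrA -E.
apply: le_trans (normc_sum _ _ _) _.
rewrite mulr_natl -[X in _ *+ X](card_ord N.+1) -sumr_const; apply: ler_sum => j _.
rewrite ComplexField.Normc.normcM !normcX (normc_unity_root pw) !expr1n mul1r.
have nj : normc (w ^+ j * s%:C%C) = s.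
  by rewrite ComplexField.Normc.normcM normcX (normc_unity_root pw) expr1n mul1r.
by have := H (w ^+ j * s%:C%C); rewrite nj; exact.
Qed.

(** Summing over the orbit of t under the N-th roots of unity kills Re p, and S(t) is one term of a
    nonnegative sum, so S is O(t^N). Hence so is Re p, and a second average, over twice as many
    roots, isolates each coefficient of p. *)
Lemma harmonic_plus_nonneg p N (S : C -> R) (B d : R) : (size p <= N)%N -> p`_0 = 0 -> 0 < d ->
  (forall t, 0 <= S t) ->
  (forall t, normc t < d -> `|complex.Re p.[t] + S t| <= B * normc t ^+ N) ->
  p = 0 /\ exists K, forall t, normc t < d -> S t <= K * normc t ^+ N.
Proof.
move=> sp p0 d0 S0 H; case: N sp H => [|N] sp H.
  have -> : p = 0 by apply/eqP; rewrite -size_poly_eq0 -leqn0.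
  split=> //; exists B => t /H; rewrite (_ : p = 0) ?horner0 ?add0r ?ger0_norm //.
  by apply/eqP; rewrite -size_poly_eq0 -leqn0.
have [w pw] := prim_root_exists (ltn0Sn N).
have HS t : normc t < d -> S t <= N.+1%:R * B * normc t ^+ N.+1.
  move=> td.
  have nj (j : 'I_N.+1) : normc (w ^+ j * t) = normc t.
    by rewrite ComplexField.Normc.normcM normcX (normc_unity_root pw) expr1n mul1r.
  have A : \sum_(j < N.+1) complex.Re p.[w ^+ j * t] = 0.
    have := coef_average t pw sp (ltn0Sn N); rewrite p0 mulr0 mul0r => E.
    rewrite -raddf_sum -[RHS](congr1 (@complex.Re R) E); congr complex.Re.
    by apply: eq_bigr => j _; rewrite subn0 exprAC (prim_expr_order pw) expr1n mul1r.
  have : S t <= \sum_(j < N.+1) S (w ^+ j * t).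
    by rewrite (bigD1 ord0) //= expr0 mul1r lerDl sumr_ge0.
  move=> /le_trans -> //.
  rewrite (_ : \sum_j S _ = \sum_(j < N.+1) (complex.Re p.[w ^+ j * t] + S (w ^+ j * t))); last first.
    by rewrite big_split /= A add0r.
  rewrite -mulrA mulr_natl -[X in _ *+ X](card_ord N.+1) -sumr_const.
  apply: ler_sum => j _; rewrite -(nj j); apply: le_trans (ler_norm _) (H _ _).
  by rewrite nj.
split; last by exists (N.+1%:R * B).
have HR t : normc t < d -> `|complex.Re p.[t]| <= (B + N.+1%:R * B) * normc t ^+ N.+1.
  move=> td; rewrite mulrDl; have h1 := H t td; have h2 := HS t td.
  rewrite (_ : complex.Re _ = (complex.Re p.[t] + S t) - S t); last by rewrite addrK.
  by apply: le_trans (ler_normB _ _) (lerD h1 _); rewrite ger0_norm.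
(* Order 2(N+1) keeps the frequencies of p and of its conjugate apart, so that averaging p + conj p
   = 2 Re p returns the coefficients of p. *)
have K0 : (0 < 2 * N.+1)%N by rewrite muln_gt0.
have [v pv] := prim_root_exists K0.
have spK : (size p <= 2 * N.+1)%N by rewrite (leq_trans sp) // leq_pmull.
apply/polyP => l; rewrite coef0.
have [->//|l0] := posnP l.
have [lN|/(leq_trans sp)/leq_sizeP->//] := ltnP l N.+1.
apply: ComplexField.Normc.eq0_normc.
apply: (@normc_ball_small _ l N.+1 (2 * (B + N.+1%:R * B)) d) => // [|s s0 sd]; first exact: normc_ge0.
have ns : normc s%:C%C = s by rewrite normc_real gtr0_norm.
have lK : (l < 2 * N.+1)%N by lia.
have E1 := coef_average (s%:C%C) pv spK lK.
have E2 : \sum_(j < 2 * N.+1) (v ^+ j) ^+ (2 * N.+1 - l) * conjc p.[v ^+ j * s%:C%C] = 0.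
  by apply: conj_average => //; rewrite ?leq_mul2l ?sp ?ltn_pmul2l.
have := congr1 (@ComplexField.Normc.normc R) (etrans (congr2 +%R E1 E2) (addr0 _)).
rewrite -big_split /= !ComplexField.Normc.normcM normcX ns.
have -> : normc ((2 * N.+1)%:R : C) = (2 * N.+1)%:R by rewrite -(rmorph_nat (real_complex R)) normc_real normr_nat.
move=> E; rewrite -(@ler_pM2l _ (2 * N.+1)%:R) ?ltr0n // mulrA -E.
apply: le_trans (normc_sum _ _ _) _.
rewrite mulr_natl -[X in _ *+ X](card_ord (2 * N.+1)) -sumr_const; apply: ler_sum => j _.
rewrite -mulrDr ComplexField.Normc.normcM !normcX (normc_unity_root pv) !expr1n mul1r.
have nj : normc (v ^+ j * s%:C%C) = s.
  by rewrite ComplexField.Normc.normcM normcX (normc_unity_root pv) expr1n mul1r.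
have := HR (v ^+ j * s%:C%C); rewrite nj => /(_ sd) h.
have -> : p.[v ^+ j * s%:C%C] + conjc p.[v ^+ j * s%:C%C] = (2 * complex.Re p.[v ^+ j * s%:C%C])%:C%C.
  by case: (p.[_]) => a b; apply/eqP; rewrite eq_complex /=; apply/andP; split; apply/eqP; ring.
by rewrite normc_real normrM ger0_norm // -mulrA ler_wpM2l.
Qed.

End Averaging.

(** * Curves *)

Section Curves.
Variables (R : realType) (n : nat).
Local Notation V := (pt R n).
Local Notation C := R[i].
Local Notation normc := ComplexField.Normc.normc.
Implicit Types (a : coeffs R n) (t z : C) (x : V).

Lemma normc_le_sum z : normc z <= `|complex.Re z| + `|complex.Im z|.
Proof.
rewrite -(@ler_pXn2r _ 2) ?nnegrE ?normc_ge0 ?addr_ge0 // sqr_normcE sqrrD.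
rewrite !real_normK ?num_real // lerD2r lerDl.
by rewrite mulrn_wge0 ?mulr_ge0.
Qed.

Lemma box_normc x : (forall j, normc (zcoord x j) < 2^-1) -> box x.
Proof.
move=> H; rewrite /box /= prod_normE gt_max; apply/andP; split; rewrite [ltLHS]mx_normrE.
  apply: bigmax_lt => // -[k j] _ /=; rewrite [k]ord1.
  by apply: le_lt_trans (H j); exact: (Re_le_normc (zcoord x j)).
apply: bigmax_lt => // -[k j] _ /=; rewrite [k]ord1.
by apply: le_lt_trans (H j); exact: (Im_le_normc (zcoord x j)).
Qed.

Lemma geometric_tail (c : nat -> R) (B q : R) N : 0 <= q -> q <= 2^-1 ->
  (forall k, `|c k| <= B * q ^+ k) ->
  `|limn (series c) - series c N| <= 2 * B * q ^+ N.
Proof.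
move=> q0 q2 H.
have B0 : 0 <= B by have := H 0%N; rewrite expr0 mulr1; exact: le_trans.
have q1 : `|q| < 1 by rewrite ger0_norm // (le_lt_trans q2) // invf_lt1 ?ltr1n.
have cM := cvg_geometric_series (a := B) q1.
apply: le_trans (dominated_tail N (cvgP _ cM) H) _.
rewrite (cvg_lim _ cM) //.
have q3 : 1 - q != 0 by rewrite gt_eqF // subr_gt0 (le_lt_trans q2) // invf_lt1 ?ltr1n.
have -> : series (fun k => B * q ^+ k) N = B * (1 - q ^+ N) / (1 - q).
  have := @geometric_seriesE _ B q; rewrite eq_sym -subr_eq0 => /(_ q3) E.
  exact: (congr1 (@^~ N) E).
rewrite (_ : _ - _ = B * q ^+ N / (1 - q)); last by field.
have P0 : 0 <= B * q ^+ N by rewrite mulr_ge0 ?exprn_ge0.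
rewrite ler_pdivrMr ?subr_gt0 ?(le_lt_trans q2) ?invf_lt1 ?ltr1n //.
rewrite (_ : 2 * B * q ^+ N * (1 - q) = B * q ^+ N * (2 - 2 * q)); last by ring.
by rewrite ler_peMr //; move: q2; lra.
Qed.

Definition trunc a N j : {poly C} := \poly_(k < N) a k j.

Lemma curve_approx a N : conv_coeffs a -> exists K d, [/\ 0 <= K, 0 < d & forall j t,
  normc t < d -> normc (zcoord (curve_eval a t) j - (trunc a N j).[t]) <= K * normc t ^+ N].
Proof.
move=> [B [rho [r0 H]]]; have B0 : 0 <= B.
  by apply: le_trans (H 0%N ord0); rewrite mulr_ge0 ?normc_ge0 ?exprn_ge0 // ltW.
(* Within half the radius the ratio is at most 1/2, so each geometric tail is at most twice its
   first term; real and imaginary parts contribute 2 each. *)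
exists (4 * B / rho ^+ N), (rho / 2); split; [|by rewrite divr_gt0|].
  by rewrite divr_ge0 ?mulr_ge0 // exprn_ge0 // ltW.
move=> j t td.
pose q := normc t / rho.
have q0 : 0 <= q by rewrite divr_ge0 ?normc_ge0 // ltW.
have q2 : q <= 2^-1 by rewrite ler_pdivrMr // mulrC ltW.
have Hc k : normc (a k j * t ^+ k) <= B * q ^+ k.
  rewrite ComplexField.Normc.normcM normcX expr_div_n mulrA ler_pdivlMr ?exprn_gt0 //.
  by rewrite mulrAC ler_wpM2r ?exprn_ge0 ?normc_ge0.
have Hr k : `|complex.Re (a k j * t ^+ k)| <= B * q ^+ k := le_trans (Re_le_normc _) (Hc k).
have Hi k : `|complex.Im (a k j * t ^+ k)| <= B * q ^+ k := le_trans (Im_le_normc _) (Hc k).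
have Er M : series (fun k => complex.Re (a k j * t ^+ k)) M = complex.Re (\sum_(k < M) a k j * t ^+ k).
  by rewrite /series /= big_mkord raddf_sum.
have Ei M : series (fun k => complex.Im (a k j * t ^+ k)) M = complex.Im (\sum_(k < M) a k j * t ^+ k).
  by rewrite /series /= big_mkord raddf_sum.
apply: le_trans (normc_le_sum _) _.
rewrite /zcoord /= !mxE /trunc horner_poly !raddfB /= -Er -Ei.
rewrite (_ : (fun M => complex.Re _) = series (fun k => complex.Re (a k j * t ^+ k))); last first.
  by apply/funext => M; rewrite Er.
rewrite (_ : (fun M => complex.Im _) = series (fun k => complex.Im (a k j * t ^+ k))); last first.
  by apply/funext => M; rewrite Ei.
apply: le_trans (lerD (geometric_tail N q0 q2 Hr) (geometric_tail N q0 q2 Hi)) _.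
rewrite /q expr_div_n le_eqVlt; apply/orP; left; apply/eqP.
by field; rewrite ?expf_neq0 ?gt_eqF.
Qed.

End Curves.

(** * Coefficient estimates for composition with a power series *)

Section Composition.
Variable R : realType.
Local Notation C := R[i].
Local Notation normc := ComplexField.Normc.normc.

Lemma normcB_le (u v : C) : normc (u - v) <= normc u + normc v.
Proof. by apply: le_trans (le_normcD _ _) _; rewrite (normcN (v : Rcomplex R)). Qed.

(* Division by a power series of order [d], in the norm [sup_k |f_k| r^k] with [r] small. *)
Lemma division_bound (d : nat) (bb : {poly C}) (B s r : R) : 0 < r -> r <= s / 2 ->
  (forall k, (k < d)%N -> bb`_k = 0) -> 0 < normc bb`_d -> 0 <= B ->
  (forall k, normc bb`_k <= B / s ^+ k) -> 4 * B / s ^+ d * (r / s) <= normc bb`_d ->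
  forall (Q : {poly C}) (M : R) (m : nat), 0 <= M ->
    (forall k, (k <= m)%N -> normc (bb * Q)`_k <= M / r ^+ k) ->
    forall k, (k + d <= m)%N -> normc Q`_k <= 2 / (r ^+ d * normc bb`_d) * M / r ^+ k.
Proof.
move=> r0 rs bd0 bdn0 B0 Bb Br Q M m M0 HF k.
have s0 : 0 < s by move: rs r0; lra.
set L := 2 / _.
have L0 : 0 <= L by rewrite divr_ge0 // mulr_ge0 ?normc_ge0 // exprn_ge0 // ltW.
elim/ltn_ind: k => k IH km.
have q0 : 0 <= r / s by rewrite divr_ge0 // ltW.
have q2 : r / s <= 2^-1 by rewrite ler_pdivrMr // mulrC.
(* Solving this for the k-th coefficient of Q gives the recursion behind the strong induction. *)
have E : (bb * Q)`_(k + d) = bb`_d * Q`_k + \sum_(j < k) bb`_(k + d - j) * Q`_j.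
  rewrite mulrC coefM -(big_mkord xpredT (fun j => Q`_j * bb`_(k + d - j))).
  rewrite (@big_cat_nat _ _ _ k) //=; last by rewrite ltnW // ltnS leq_addr.
  rewrite addrC big_ltn ?ltnS ?leq_addr // addKn mulrC -addrA; congr (_ + _).
  rewrite big_nat_cond big1 ?add0r => [|j /andP[/andP[kj jd] _]]; last first.
    by rewrite bd0 ?mulr0 //; move: kj jd; clear; lia.
  by rewrite big_mkord; apply: eq_bigr => j _; rewrite mulrC.
have geo : \sum_(j < k) (r / s) ^+ (k - j) <= 2 * (r / s).
  elim: (k) => [|k' IHk]; first by rewrite big_ord0 mulr_ge0.
  rewrite big_ord_recr /= subSnn expr1.
  rewrite (eq_bigr (fun j : 'I_k' => r / s * (r / s) ^+ (k' - j))) => [|j _]; last first.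
    by rewrite subSn ?exprS // ltnW.
  rewrite -mulr_sumr; apply: (@le_trans _ _ (r / s * (2 * (r / s)) + r / s)).
    by rewrite lerD2r ler_wpM2l.
  by move: (r / s) q0 q2 => q *; nra.
have : normc (bb`_d * Q`_k) <= M / r ^+ (k + d) + (B / s ^+ d * L * M / r ^+ k) * (2 * (r / s)).
  rewrite (_ : bb`_d * Q`_k = (bb * Q)`_(k + d) - \sum_(j < k) bb`_(k + d - j) * Q`_j); last first.
    by rewrite E addrK.
  apply: le_trans (normcB_le _ _) _; apply: lerD; first exact: HF.
  apply: le_trans (normc_sum _ _ _) _.
  apply: (@le_trans _ _ ((B / s ^+ d * L * M / r ^+ k) * \sum_(j < k) (r / s) ^+ (k - j))); last first.
    have P1 : 0 <= B / s ^+ d by rewrite divr_ge0 // exprn_ge0 // ltW.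
    have P2 : 0 <= (r ^+ k)^-1 by rewrite invr_ge0 exprn_ge0 // ltW.
    exact: (ler_wpM2l (mulr_ge0 (mulr_ge0 (mulr_ge0 P1 L0) M0) P2) geo).
  rewrite mulr_sumr; apply: ler_sum => j _; have jk := ltn_ord j.
  rewrite ComplexField.Normc.normcM.
  apply: le_trans (ler_pM (normc_ge0 _) (normc_ge0 _) (Bb _) (IH _ jk _)) _.
    by apply: leq_trans km; rewrite leq_add2r ltnW.
  have -> : (k + d - j = d + (k - j))%N by rewrite [(k + d)%N]addnC addnBA // ltnW.
  have -> : r ^+ k = r ^+ j * r ^+ (k - j) by rewrite -exprD subnKC // ltnW.
  rewrite !exprD expr_div_n le_eqVlt; apply/orP; left; apply/eqP.
  by field; rewrite !expf_neq0 // gt_eqF.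
rewrite ComplexField.Normc.normcM => H.
rewrite -(ler_pM2l bdn0); apply: le_trans H _.
(* The 2 in L provides two equal shares: one for the coefficient of the product, one for the
   convolution with earlier coefficients, which [Br] makes small enough. *)
have -> : normc bb`_d * (L * M / r ^+ k) = M / r ^+ (k + d) + M / r ^+ (k + d).
  by rewrite /L exprD; field; rewrite !expf_neq0 ?gt_eqF.
rewrite lerD2l.
have -> : M / r ^+ (k + d) = normc bb`_d * (L * M / r ^+ k) / 2.
  by rewrite /L exprD; field; rewrite !expf_neq0 ?gt_eqF.
have e0 : 0 <= L * M / r ^+ k by apply: divr_ge0; [exact: mulr_ge0|rewrite exprn_ge0 // ltW].
have := ler_wpM2r e0 Br.
rewrite (_ : 4 * B / s ^+ d * (r / s) * (L * M / r ^+ k) = 2 * (B / s ^+ d * L * M / r ^+ k * (2 * (r / s)))); last by ring.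
move=> h; rewrite ler_pdivlMr // mulrC.
by move: h; rewrite !mulrA.
Qed.

(** Horner form of the sum of c_j b^(j+1): dividing by b exposes the first coefficient and leaves a
    sum of the same shape. *)
Definition shifted_sum (bb : {poly C}) (s : seq C) : {poly C} :=
  foldr (fun c W => bb * (c%:P + W)) 0 s.

Lemma shifted_sumE bb s : shifted_sum bb s = \sum_(j < size s) s`_j *: bb ^+ j.+1.
Proof.
elim: s => [|c s IH] /=; first by rewrite big_ord0.
rewrite big_ord_recl /= -/(shifted_sum bb s) IH mulrDr mulr_sumr expr1 mulrC mul_polyC.
by congr (_ + _); apply: eq_bigr => j _; rewrite -scalerAr -exprS.
Qed.

(** Each division by b multiplies the bound by L = 2/(r^d |b_d|) and costs d orders of precision.
    Coefficient i appears as a constant term after i + 1 divisions. *)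
Lemma shifted_sum_coef_bound (d : nat) (bb : {poly C}) (B s r : R) : 0 < r -> r <= s / 2 -> (0 < d)%N ->
  (forall k, (k < d)%N -> bb`_k = 0) -> 0 < normc bb`_d -> 0 <= B ->
  (forall k, normc bb`_k <= B / s ^+ k) -> 4 * B / s ^+ d * (r / s) <= normc bb`_d ->
  forall (cs : seq C) (M : R) (m : nat), 0 <= M ->
    (forall k, (k <= m)%N -> normc (shifted_sum bb cs)`_k <= M / r ^+ k) ->
    forall i, (i < size cs)%N -> (d * i.+1 <= m)%N ->
      normc cs`_i <= (2 / (r ^+ d * normc bb`_d)) ^+ i.+1 * M.
Proof.
move=> r0 rs d0 bd0 bdn0 B0 Bb Br; set L := 2 / _.
have L0 : 0 <= L by rewrite divr_ge0 // mulr_ge0 ?normc_ge0 // exprn_ge0 // ltW.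
elim=> [//|c cs IH] M m M0 HM i si di /=.
have D := division_bound r0 rs bd0 bdn0 B0 Bb Br M0 HM.
have W0 : (shifted_sum bb cs)`_0 = 0.
  case: (cs) => [|c' cs'] /=; first by rewrite coef0.
  by rewrite coef0M bd0 // mul0r.
case: i si di => [_|i si] di /=.
  have := D 0%N; rewrite add0n coefD coefC /= W0 addr0 expr0 divr1 expr1; apply.
  by apply: leq_trans di; rewrite leq_pmulr.
rewrite exprSr -mulrA; apply: (IH (L * M) (m - d)%N) => //; first exact: mulr_ge0.
  move=> [|k] km; first by rewrite W0 ComplexField.Normc.normc0 expr0 divr1 mulr_ge0.
  have := D k.+1; rewrite coefD coefC /= add0r; apply.
  by apply: leq_trans (_ : (m - d + d <= _)%N); [rewrite leq_add2r|rewrite subnK // (leq_trans _ di) // leq_pmulr].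
rewrite leq_subRL; first by move: di; rewrite mulnS.
by apply: leq_trans di; rewrite leq_pmulr.
Qed.

End Composition.

(** * The hypersurface *)

Section Hypersurface.
Variables (R : realType) (n : nat) (i1 i2 i3 : 'I_n.+1).
Hypotheses (n12 : i1 != i2) (n13 : i1 != i3) (n23 : i2 != i3).
Local Notation V := (pt R n).
Local Notation C := R[i].
Local Notation normc := ComplexField.Normc.normc.
Implicit Types (x : V) (t z : C) (a : coeffs R n).

Definition cusp x : C := zcoord x i1 ^+ 2 - zcoord x i2 ^+ 3.

Definition others : seq 'I_n.+1 := [seq j <- enum 'I_n.+1 | [&& j != i1, j != i2 & j != i3]].

Definition squares x : R := normc (cusp x) ^+ 2 + \sum_(j <- others) normc (zcoord x j) ^+ 2.

Lemma hol_cusp : exists A B : V -> R, hol A B /\ forall x, cusp x = Complex (A x) (B x).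
Proof.
have h1 := hol_coord R i1; have h2 := hol_coord R i2.
have H := holD (holM h1 h1) (holM (hol_cst n (-1) 0) (holM h2 (holM h2 h2))).
do 2 eexists; split; first exact: H.
move=> x; rewrite /cusp /zcoord !exprS expr0 !mulr1 /=.
by apply/eqP; rewrite eq_complex /=; apply/andP; split; apply/eqP; ring.
Qed.

Lemma squares_elem_psh : elem squares /\ forall x, psh_at squares x.
Proof.
have [A [B [hAB cE]]] := hol_cusp.
have [eA eB] := hol_elem hAB.
pose Q (j : 'I_n.+1) x : R := x.1 0 j * x.1 0 j + x.2 0 j * x.2 0 j.
have eQ j : elem (Q j) by apply: elemD; apply: elemM; first [exact: elem_re|exact: elem_im].
have -> : squares = (fun x => (A x * A x + B x * B x) + \sum_(j <- others) Q j x).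
  apply/funext => x; rewrite /squares sqr_normcE cE; congr (_ + _).
  by apply: eq_bigr => j _; rewrite sqr_normcE.
have e1 : elem (fun x => A x * A x + B x * B x) by apply: elemD; exact: elemM.
have e2 : elem (fun x => \sum_(j <- others) Q j x) by apply: elem_sum.
split=> [|x]; first exact: elemD.
apply: (psh_elemD e1 e2); first exact: psh_hol_sqr.
apply: psh_sum => // j; exact: (psh_hol_sqr x (hol_coord R j)).
Qed.

Definition base x : R := x.1 0 i3 + squares x.

Lemma elem_base : elem base.
Proof. by apply: elemD; [exact: elem_re|case: squares_elem_psh]. Qed.

Lemma psh_base x : psh_at base x.
Proof.
have [e p] := squares_elem_psh.
by apply: (psh_elemD (elem_re i3) e) => //; exact: (psh_hol_re x (hol_coord R i3)).
Qed.

Lemma squares_shift s x : squares (s *: ex R i3 + x) = squares x.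
Proof.
have E j : j != i3 -> zcoord (s *: ex R i3 + x) j = zcoord x j.
  by move=> /negbTE ji; rewrite /zcoord /= !mxE ji !mulr0 !add0r.
rewrite /squares /cusp !E //; congr (_ + _).
rewrite big_seq [RHS]big_seq; apply: eq_bigr => j.
by rewrite mem_filter => /andP[/and3P[_ _ j3] _]; rewrite E.
Qed.

Lemma dd_invariant (f : V -> R) v : (forall s x, f (s *: v + x) = f x) -> dd v f = (fun=> 0).
Proof.
move=> H; rewrite ddE; apply/funext => x; rewrite /derive.
rewrite (_ : (fun h => _) = (fun=> 0)); first exact: lim_cst.
by apply/funext => h /=; rewrite H subrr scaler0.
Qed.

Lemma dd_base : dd (ex R i3) base = (fun=> 1).
Proof.
have [e _] := squares_elem_psh.
rewrite /base (ddD _ (elem_re i3) e) dd_re (dd_invariant squares_shift).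
by apply/funext => x; rewrite /= mxE eqxx addr0.
Qed.

Section WithPotential.
Variables (F : nat -> V -> R) (h : nat -> R).
Hypothesis eF : forall k, elem (F k).
Hypothesis dF : dominated F.
Hypothesis pF : forall k x, box x -> psh_at (F k) x.
Hypothesis F0 : forall k (v : V), v.1 0 i2 = 0 -> v.2 0 i2 = 0 -> dd v (F k) = (fun=> 0).
Hypothesis Fh : forall N, exists B, forall x, box x ->
  `|ssum F x - \sum_(m < N) h m * complex.Re (zcoord x i2 ^+ m.+1)|
     <= B * normc (zcoord x i2) ^+ N.+1.
Hypothesis hbig : forall L M, exists m, M * L ^+ m.+1 < h m.

(** The elementary part is made term 0 of the series, so the results on dominated series cover the
    whole defining function. *)
Definition terms (k : nat) : V -> R := if k is k'.+1 then F k' else base.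
Definition defining_fun : V -> R := ssum terms.

Lemma elem_terms k : elem (terms k).
Proof. by case: k => [|k]; [exact: elem_base|exact: eF]. Qed.

Lemma cvg_series_cons (c : nat -> R) l : series (fun k => c k.+1) N @[N --> \oo] --> l ->
  series c N @[N --> \oo] --> c 0%N + l.
Proof.
move=> cl; rewrite -cvg_shiftS.
rewrite (_ : (fun N => _) = (fun N => c 0%N + series (fun k => c k.+1) N)).
  by apply: cvgD => //; exact: cvg_cst.
by apply/funext => N; rewrite /series /= big_nat_recl.
Qed.

Lemma dominated_terms : dominated terms.
Proof.
move=> vs; have [M cM HM] := dF vs.
have [B B0 HB] := foldr_dd_bounded (size vs) elem_base.
exists (fun k => if k is k'.+1 then M k' else B * \prod_(v <- vs) conorm v).
  exact: (cvgP _ (cvg_series_cons (c := fun k => if k is k'.+1 then M k' else _) cM)).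
by case=> [|k] x bx; [exact: HB|exact: HM].
Qed.

Lemma defining_funE x : box x -> defining_fun x = base x + ssum F x.
Proof.
move=> bx; have cF := ssum_cvg dF bx.
apply/cvg_lim => //; exact: (cvg_series_cons (c := fun k => terms k x) cF).
Qed.

Lemma zcoord0 j : zcoord (0 : V) j = 0.
Proof. by rewrite /zcoord /= !mxE. Qed.

Lemma ssum0 : ssum F 0 = 0.
Proof.
have [B HB] := Fh 0; have := HB 0 (@box0 R n).
by rewrite big_ord0 subr0 zcoord0 ComplexField.Normc.normc0 expr1 mulr0 normr_le0 => /eqP.
Qed.

Lemma defining_fun0 : defining_fun 0 = 0.
Proof.
rewrite defining_funE; last exact: box0.
rewrite ssum0 addr0 /base (_ : (0 : V).1 0 i3 = 0) ?mxE // add0r.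
have z2 : ((0 : C) ^+ 2 = 0) * ((0 : C) ^+ 3 = 0) * ((0 : R) ^+ 2 = 0) by rewrite !expr0n.
rewrite /squares /cusp !zcoord0 !z2 subr0 ComplexField.Normc.normc0 z2 add0r big1 // => j _.
by rewrite zcoord0 ComplexField.Normc.normc0 z2.
Qed.

Lemma defining_fun_smooth : smooth_on (@box R n) defining_fun.
Proof. exact: (ssum_smooth elem_terms dominated_terms). Qed.

Lemma defining_fun_grad x : box x -> grad_nonzero defining_fun x.
Proof.
move=> bx; exists i3; left.
have [_ ->] := ssum_is_derive (ex R i3) elem_terms dominated_terms bx.
have d0 k : dd (ex R i3) (F k) = (fun=> 0).
  by apply: F0; rewrite /= mxE // (negbTE n23).
have c0 : series (fun k => dd (ex R i3) (terms k.+1) x) N @[N --> \oo] --> (0 : R).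
  rewrite (_ : (fun N => _) = (fun=> 0)); first exact: cvg_cst.
  by apply/funext => N; rewrite /series /= big1 // => k _; rewrite d0.
have E : ssum (fun k => dd (ex R i3) (terms k)) x = 1.
  apply/cvg_lim => //; have := cvg_series_cons (c := fun k => dd (ex R i3) (terms k) x) c0.
  by rewrite /= dd_base addr0.
by rewrite E oner_neq0.
Qed.

Lemma defining_fun_psh : pseudoconvex_on (@box R n) defining_fun.
Proof.
move=> x bx _ w _; apply: (psh_ssum elem_terms dominated_terms bx) => -[|k].
  exact: psh_base.
exact: pF.
Qed.

(** * Contact of curves with the hypersurface *)

Lemma normc_subX (u v : C) m : normc u <= 1 -> normc v <= 1 ->
  normc (u ^+ m - v ^+ m) <= m%:R * normc (u - v).
Proof.
move=> u1 v1; rewrite subrXX ComplexField.Normc.normcM mulrC ler_wpM2r ?normc_ge0 //.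
apply: le_trans (normc_sum _ _ _) _.
rewrite -[X in X%:R](card_ord m) -sumr_const; apply: ler_sum => k _.
by rewrite ComplexField.Normc.normcM !normcX mulr_ile1 ?exprn_ge0 ?normc_ge0 // exprn_ile1 ?normc_ge0.
Qed.

Lemma poly_bounded_disc (q : {poly C}) : exists2 K, 0 <= K & forall t, normc t <= 1 -> normc q.[t] <= K.
Proof.
exists (\sum_(k < size q) normc q`_k) => [|t t1].
  by apply: sumr_ge0 => k _; exact: normc_ge0.
rewrite horner_coef; apply: le_trans (normc_sum _ _ _) _; apply: ler_sum => k _.
by rewrite ComplexField.Normc.normcM normcX ler_piMr ?normc_ge0 // exprn_ile1 ?normc_ge0.
Qed.

(** Up to degree N these are the coefficients of w + h(z2) along the curve: z2 is O(t), so later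
    terms of h do not reach that degree. *)
Definition harmonic_poly a N : {poly C} :=
  trunc a N.+1 i3 + \sum_(m < N) (h m)%:C%C *: trunc a N.+1 i2 ^+ m.+1.

Lemma curve_small a : conv_coeffs a -> (forall j, a 0%N j = 0) ->
  exists K d, [/\ 0 <= K, 0 < d & forall j t, normc t < d -> normc (zcoord (curve_eval a t) j) <= K * normc t].
Proof.
move=> ca a0; have [K [d [K0 d0 H]]] := curve_approx 1 ca.
exists K, d; split=> // j t /(H j); rewrite /trunc horner_poly big_ord_recl big_ord0 a0.
by rewrite mul0r addr0 subr0 expr1.
Qed.

Lemma curve_control a N : conv_coeffs a -> (forall j, a 0%N j = 0) ->
  exists K d, [/\ 0 <= K, 0 < d & forall t, normc t < d ->
    [/\ normc t <= 1, box (curve_eval a t),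
        forall j, normc (zcoord (curve_eval a t) j) <= K * normc t,
        forall j, normc (zcoord (curve_eval a t) j) <= 1 /\ normc (trunc a N j).[t] <= 1
      & forall j, normc (zcoord (curve_eval a t) j - (trunc a N j).[t]) <= K * normc t ^+ N]].
Proof.
move=> ca a0.
have [K1 [d1 [K10 d10 H1]]] := curve_small ca a0.
have [K2 [d2 [K20 d20 H2]]] := curve_approx N ca.
(* The truncations have no constant term, so a factor t splits off. *)
have [K3 K30 H3] : exists2 K, 0 <= K & forall j t, normc t <= 1 -> normc (trunc a N j).[t] <= K * normc t.
  have HQ j : exists q : {poly C}, trunc a N j = q * 'X.
    exists (drop_poly 1 (trunc a N j)).
    rewrite -[LHS](poly_take_drop 1) expr1 -[RHS]add0r; congr (_ + _).
    apply/polyP => k; rewrite coef_take_poly coef0; case: ifP => //.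
    by case: k => // _; rewrite coef_poly a0; case: ifP.
  have [q Hq] := choice HQ.
  have HK j : exists K, 0 <= K /\ forall t, normc t <= 1 -> normc (q j).[t] <= K.
    by have [K K0 HK] := poly_bounded_disc (q j); exists K.
  have [K HK'] := choice HK.
  exists (\sum_j K j) => [|j t t1]; first by apply: sumr_ge0 => j _; case: (HK' j).
  rewrite Hq hornerM hornerX ComplexField.Normc.normcM ler_wpM2r ?normc_ge0 //.
  apply: le_trans ((HK' j).2 t t1) _; rewrite (bigD1 j) //= lerDl; apply: sumr_ge0 => k _.
  by case: (HK' k).
pose D := K1 + K2 + K3 + 1.
have D1 : 1 <= D by rewrite /D; lra.
have D0 : 0 < D by exact: lt_le_trans D1.
exists D, (Num.min (Num.min d1 d2) (4^-1 / D)); split; first exact: ltW.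
  by rewrite !lt_min d10 d20 divr_gt0 // invr_gt0.
move=> t; rewrite !lt_min => /andP[/andP[td1 td2]]; rewrite ltr_pdivlMr // => tD.
have t0 := normc_ge0 t.
have t1 : normc t <= 1 by nra.
have h1 j : normc (zcoord (curve_eval a t) j) <= D * normc t.
  by apply: le_trans (H1 j t td1) _; rewrite ler_wpM2r // /D; lra.
have h4 j : normc (zcoord (curve_eval a t) j) < 2^-1.
  by apply: le_lt_trans (h1 j) _; move: tD; lra.
split=> //.
- exact: box_normc.
- move=> j; split; first by apply: ltW; apply: lt_trans (h4 j) _; lra.
  apply: le_trans (H3 j t t1) _; apply: (@le_trans _ _ (D * normc t)); last by move: tD; lra.
  by rewrite ler_wpM2r // /D; lra.
move=> j; apply: le_trans (H2 j t td2) _.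
by rewrite ler_wpM2r ?exprn_ge0 // /D; lra.
Qed.

Lemma curve_expansion a N : conv_coeffs a -> (forall j, a 0%N j = 0) ->
  exists B d, 0 < d /\ forall t, normc t < d ->
   `|defining_fun (curve_eval a t) - (complex.Re (take_poly N.+1 (harmonic_poly a N)).[t] + squares (curve_eval a t))|
     <= B * normc t ^+ N.+1.
Proof.
move=> ca a0.
have [K [d [K0 d0 H]]] := curve_control N.+1 ca a0.
have [B HB] := Fh N.
have [D D0 HD] := poly_bounded_disc (drop_poly N.+1 (harmonic_poly a N)).
pose S := \sum_(m < N) `|h m| * (m.+1%:R * K).
(* Four errors: truncating w, the Taylor remainder of the potential, replacing z2 by its truncation,
   and dropping degrees above N. *)
exists (K + `|B| * K ^+ N.+1 + S + D), d; split=> // t td.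
have [t1 bx zK z1 zt] := H t td.
set x := curve_eval a t; set Z := normc t ^+ N.+1.
have Z0 : 0 <= Z by rewrite exprn_ge0 ?normc_ge0.
rewrite defining_funE // /base.
set P := harmonic_poly a N.
have PE : P.[t] = (take_poly N.+1 P).[t] + (drop_poly N.+1 P).[t] * t ^+ N.+1.
  by rewrite -[in LHS](poly_take_drop N.+1 P) hornerD hornerM hornerXn.
have PE' : P.[t] = (trunc a N.+1 i3).[t] + \sum_(m < N) (h m)%:C%C * (trunc a N.+1 i2).[t] ^+ m.+1.
  rewrite /P /harmonic_poly hornerD horner_sum; congr (_ + _).
  by apply: eq_bigr => m _; rewrite hornerZ horner_exp.
have e1 : `|x.1 0 i3 - complex.Re (trunc a N.+1 i3).[t]| <= K * Z.
  rewrite -[x.1 0 i3]/(complex.Re (zcoord x i3)) -raddfB.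
  exact: le_trans (Re_le_normc _) (zt i3).
have e2 : `|ssum F x - \sum_(m < N) h m * complex.Re (zcoord x i2 ^+ m.+1)| <= `|B| * K ^+ N.+1 * Z.
  apply: le_trans (HB x bx) _; rewrite -mulrA -exprMn.
  apply: (@le_trans _ _ (`|B| * normc (zcoord x i2) ^+ N.+1)).
    by rewrite ler_wpM2r ?ler_norm // exprn_ge0 ?normc_ge0.
  by rewrite ler_wpM2l // lerXn2r ?nnegrE ?normc_ge0 ?mulr_ge0 ?normc_ge0 //; exact: zK.
have e3 : `|\sum_(m < N) h m * complex.Re (zcoord x i2 ^+ m.+1)
   - \sum_(m < N) h m * complex.Re ((trunc a N.+1 i2).[t] ^+ m.+1)| <= S * Z.
  rewrite -sumrB; apply: le_trans (ler_norm_sum _ _ _) _; rewrite mulr_suml.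
  apply: ler_sum => m _; rewrite -mulrBr normrM -mulrA ler_wpM2l // -raddfB.
  apply: le_trans (Re_le_normc _) _.
  have [zz tt] := z1 i2; apply: le_trans (normc_subX _ zz tt) _.
  by rewrite -mulrA ler_wpM2l //; exact: zt.
have e4 : `|complex.Re ((drop_poly N.+1 P).[t] * t ^+ N.+1)| <= D * Z.
  apply: le_trans (Re_le_normc _) _; rewrite ComplexField.Normc.normcM normcX.
  by rewrite ler_wpM2r //; exact: HD.
have RE : complex.Re P.[t] = complex.Re (trunc a N.+1 i3).[t] +
    \sum_(m < N) h m * complex.Re ((trunc a N.+1 i2).[t] ^+ m.+1).
  rewrite PE' raddfD raddf_sum /=; congr (_ + _); apply: eq_bigr => m _.
  by case: (_ ^+ m.+1) => u v /=; rewrite mul0r subr0.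
have RE2 : complex.Re P.[t] = complex.Re (take_poly N.+1 P).[t] + complex.Re ((drop_poly N.+1 P).[t] * t ^+ N.+1).
  by rewrite PE raddfD.
move: e1 e2 e3 e4 RE RE2.
move: (x.1 0 i3) (ssum F x) (\sum_(m < N) h m * complex.Re (zcoord x i2 ^+ m.+1)) => X u T1.
move: (\sum_(m < N) _) (complex.Re (trunc a N.+1 i3).[t]) (complex.Re P.[t]) => T2 W PP.
move: (complex.Re (take_poly N.+1 P).[t]) (complex.Re (_ * _)) (squares x) => p q s e1 e2 e3 e4 RE RE2.
have -> : p = W + T2 - q by rewrite -RE RE2 addrK.
rewrite (_ : _ - _ = (X - W) + (u - T1) + (T1 - T2) + q); last by ring.
apply: le_trans (ler_normD _ _) _; rewrite 3!mulrDl; apply: lerD => //.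
apply: le_trans (ler_normD _ _) _; apply: lerD => //.
by apply: le_trans (ler_normD _ _) _; apply: lerD.
Qed.


Lemma vanishes_consequence a N : conv_coeffs a -> (forall j, a 0%N j = 0) ->
  vanishes_to (defining_fun \o curve_eval a) N.+1 ->
  take_poly N.+1 (harmonic_poly a N) = 0 /\ exists K d, 0 < d /\
    forall t, normc t < d -> squares (curve_eval a t) <= K * normc t ^+ N.+1.
Proof.
move=> ca a0 [B1 [d1 [d10 H1]]].
have [B2 [d2 [d20 H2]]] := curve_expansion N ca a0.
have sq0 x : 0 <= squares x.
  by rewrite addr_ge0 ?sqr_ge0 // sumr_ge0 // => j _; exact: sqr_ge0.
have d0 : 0 < Num.min d1 d2 by rewrite lt_min d10.
have c0 : (take_poly N.+1 (harmonic_poly a N))`_0 = 0.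
  rewrite coef_take_poly /= /harmonic_poly coefD coef_poly /= a0 add0r coef_sum big1 // => m _.
  by rewrite coefZ exprS coef0M coef_poly a0 /= mul0r mulr0.
have [|p0 [K HK]] := @harmonic_plus_nonneg _ _ N.+1 (fun t => squares (curve_eval a t)) (B1 + B2) _
  (size_take_poly _ _) c0 d0 (fun t => sq0 _).
  move=> t; rewrite lt_min => /andP[t1 t2].
  have h1 := H1 t t1; have h2 := H2 t t2; rewrite mulrDl.
  set e := _ + squares _; rewrite (_ : e = defining_fun (curve_eval a t) - (defining_fun (curve_eval a t) - e)); last by ring.
  by apply: le_trans (ler_normB _ _) (lerD h1 h2).
by split=> //; exists K, (Num.min d1 d2).
Qed.

Lemma squares_ge_cusp x : normc (cusp x) ^+ 2 <= squares x.
Proof. by rewrite lerDl sumr_ge0 // => j _; exact: sqr_ge0. Qed.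

Lemma squares_ge_other x j : j != i1 -> j != i2 -> j != i3 -> normc (zcoord x j) ^+ 2 <= squares x.
Proof.
move=> j1 j2 j3; apply: (@le_trans _ _ (\sum_(k <- others) normc (zcoord x k) ^+ 2)); last first.
  by rewrite lerDr sqr_ge0.
have jo : j \in others by rewrite mem_filter j1 j2 j3 mem_enum.
rewrite (big_rem j jo) /= lerDl sumr_ge0 // => k _; exact: sqr_ge0.
Qed.

(** [|K| + 1] stands in for the square root of K, whose square it dominates. *)
Lemma sqr_le_sqr (u y K : R) : 0 <= u -> 0 <= y -> u ^+ 2 <= K * y ^+ 2 -> u <= (`|K| + 1) * y.
Proof.
move=> u0 y0 H; rewrite -(@ler_pXn2r _ 2) ?nnegrE ?mulr_ge0 ?addr_ge0 //.
apply: le_trans H _; rewrite exprMn ler_wpM2r ?sqr_ge0 //.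
by apply: le_trans (ler_norm K) _; have := normr_ge0 K; nra.
Qed.

Lemma cusp_approx a M : conv_coeffs a -> (forall j, a 0%N j = 0) ->
  exists K d, 0 < d /\ forall t, normc t < d ->
    normc (cusp (curve_eval a t) - (trunc a M i1 ^+ 2 - trunc a M i2 ^+ 3).[t]) <= K * normc t ^+ M.
Proof.
move=> ca a0; have [K [d [K0 d0 H]]] := curve_control M ca a0.
exists (2 * K + 3 * K), d; split=> // t td; have [t1 bx zK z1 zt] := H t td.
rewrite hornerD hornerN !horner_exp /cusp.
set u1 := zcoord _ i1; set u2 := zcoord _ i2; set v1 := _.[t]; set v2 := (trunc a M i2).[t].
rewrite (_ : _ - _ = (u1 ^+ 2 - v1 ^+ 2) - (u2 ^+ 3 - v2 ^+ 3)); last by ring.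
apply: le_trans (normcB_le _ _) _; rewrite mulrDl -!mulrA; apply: lerD.
  have [zz tt] := z1 i1; apply: le_trans (normc_subX _ zz tt) _.
  by rewrite ler_wpM2l //; exact: zt.
have [zz tt] := z1 i2; apply: le_trans (normc_subX _ zz tt) _.
by rewrite ler_wpM2l //; exact: zt.
Qed.

Lemma take_poly_small (p : {poly C}) M K d : 0 < d ->
  (forall t, normc t < d -> normc p.[t] <= K * normc t ^+ M) -> take_poly M p = 0.
Proof.
move=> d0 H; have [D D0 HD] := poly_bounded_disc (drop_poly M p).
apply: (@poly_small_eq0 _ _ M (K + D) (Num.min d 1)); [exact: size_take_poly|by rewrite lt_min d0 ltr01|].
move=> t; rewrite lt_min => /andP[td t1].
rewrite (_ : (take_poly M p).[t] = p.[t] - (drop_poly M p).[t] * t ^+ M); last first.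
  by rewrite -[in p.[t]](poly_take_drop M p) hornerD hornerM hornerXn addrK.
apply: le_trans (normcB_le _ _) _; rewrite mulrDl; apply: lerD; first exact: H.
rewrite ComplexField.Normc.normcM normcX ler_wpM2r ?exprn_ge0 ?normc_ge0 //.
by apply: HD; exact: ltW.
Qed.

(** Contact 2(M+1) passes in full to the harmonic part, but the squares give only order M+1 for the
    cusp equation and the remaining coordinates. *)
Lemma vanishes_coefs a M : conv_coeffs a -> (forall j, a 0%N j = 0) ->
  vanishes_to (defining_fun \o curve_eval a) M.*2.+2 ->
  [/\ take_poly M.*2.+2 (harmonic_poly a M.*2.+1) = 0,
      take_poly M.+1 (trunc a M.+1 i1 ^+ 2 - trunc a M.+1 i2 ^+ 3) = 0
    & forall j, j != i1 -> j != i2 -> j != i3 -> trunc a M.+1 j = 0].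
Proof.
move=> ca a0 /(vanishes_consequence ca a0) [p0 [K [d [d0 HK]]]].
have root (f : C -> C) : (forall t, normc (f t) ^+ 2 <= squares (curve_eval a t)) ->
    forall t, normc t < d -> normc (f t) <= (`|K| + 1) * normc t ^+ M.+1.
  move=> Hf t td; apply: sqr_le_sqr; rewrite ?exprn_ge0 ?normc_ge0 //.
  rewrite -exprM muln2 doubleS; exact: le_trans (Hf t) (HK t td).
split=> // [|j j1 j2 j3].
  have [K' [d' [d'0 H']]] := cusp_approx M.+1 ca a0.
  apply: (@take_poly_small _ _ ((`|K| + 1) + K') (Num.min d d')); first by rewrite lt_min d0.
  move=> t; rewrite lt_min => /andP[td td'].
  set p := trunc a M.+1 i1 ^+ 2 - _.
  rewrite (_ : p.[t] = cusp (curve_eval a t) - (cusp (curve_eval a t) - p.[t])); last by ring.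
  apply: le_trans (normcB_le _ _) _; rewrite mulrDl; apply: lerD; last exact: H'.
  by apply: (root (fun t => cusp (curve_eval a t))) => // t'; exact: squares_ge_cusp.
have [K' [d' [K'0 d'0 H']]] := curve_approx M.+1 ca.
apply: (@poly_small_eq0 _ _ M.+1 ((`|K| + 1) + K') (Num.min d d')); [exact: size_poly|by rewrite lt_min d0|].
move=> t; rewrite lt_min => /andP[td td'].
rewrite (_ : (trunc a M.+1 j).[t] = zcoord (curve_eval a t) j -
  (zcoord (curve_eval a t) j - (trunc a M.+1 j).[t])); last by ring.
apply: le_trans (normcB_le _ _) _; rewrite mulrDl; apply: lerD; last exact: H'.
by apply: (root (fun t => zcoord (curve_eval a t) j)) => // t'; exact: squares_ge_other.
Qed.

Lemma vanishes_toW (f : C -> R) N N' : (N <= N')%N -> vanishes_to f N' -> vanishes_to f N.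
Proof.
move=> NN [B [d [d0 H]]]; exists `|B|, (Num.min d 1); split; first by rewrite lt_min d0 ltr01.
move=> t; rewrite lt_min => /andP[td t1]; apply: le_trans (H t td) _.
have t0 := normc_ge0 t.
apply: (@le_trans _ _ (`|B| * normc t ^+ N')); first by rewrite ler_wpM2r ?exprn_ge0 ?ler_norm.
by rewrite ler_wpM2l // ler_wiXn2l // ltW.
Qed.

Lemma good_curve0 a : good_curve 0 a -> conv_coeffs a /\ forall j, a 0%N j = 0.
Proof. by move=> [ca a0 _]; split=> // j; rewrite a0 zcoord0. Qed.

Lemma coef1_exp (q : {poly C}) m : q`_0 = 0 -> q`_1 = 0 -> (q ^+ m.+1)`_1 = 0.
Proof.
by move=> q0 q1; rewrite exprS coefM big_ord_recl big_ord1 /= q0 q1 !mul0r addr0.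
Qed.

Lemma coef_sum_scale N a k : (\sum_(m < N) (h m)%:C%C *: trunc a N.+1 i2 ^+ m.+1)`_k =
  \sum_(m < N) (h m)%:C%C * (trunc a N.+1 i2 ^+ m.+1)`_k.
Proof. by rewrite coef_sum; apply: eq_bigr => m _; rewrite coefZ. Qed.

(** Contact 8 gives z1^2 = z2^3 up to degree 3, the first degree in which the linear coefficient of
    z2 shows. All linear coefficients then vanish. *)
Lemma regular_order a N : good_curve 0 a -> curve_ord a 1 -> vanishes_to (defining_fun \o curve_eval a) N -> (N <= 7)%N.
Proof.
move=> /good_curve0 [ca a0] [_ [[j aj] _]] vN; rewrite leqNgt; apply/negP => N7.
have /(vanishes_coefs (M := 3) ca a0) [p0 g0 o0] := vanishes_toW N7 vN.
have tE k : (k < 4)%N -> forall l, (trunc a 4 l)`_k = a k l by move=> k4 l; rewrite coef_poly k4.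
set A := trunc a 4 i1 in g0; set B := trunc a 4 i2 in g0.
have A0 : A`_0 = 0 by rewrite tE.
have B0 : B`_0 = 0 by rewrite tE.
have c k : (k < 4)%N -> (A ^+ 2)`_k = (B ^+ 3)`_k.
  move=> k4; have := congr1 (fun p : {poly C} => p`_k) g0.
  by rewrite coef_take_poly k4 coefB coef0 => /eqP; rewrite subr_eq0 => /eqP.
have B20 : (B ^+ 2)`_0 = 0 by rewrite expr2 coef0M B0 mul0r.
have B21 : (B ^+ 2)`_1 = 0 by rewrite expr2 coefM big_ord_recl big_ord1 /= B0 mul0r mulr0 addr0.
have B22 : (B ^+ 2)`_2 = B`_1 ^+ 2.
  by rewrite expr2 coefM !big_ord_recl big_ord0 /= B0 mul0r mulr0 addr0 add0r addr0 -expr2.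
(* In degree 2 the cube contributes nothing, so the square of this coefficient is 0. *)
have A1 : A`_1 = 0.
  have := c 2 isT; rewrite exprS expr1 coefM !big_ord_recl big_ord0 /= A0 mul0r mulr0 !addr0 add0r.
  rewrite exprS coefM !big_ord_recl big_ord0 /= B0 B21 B20 mul0r !mulr0 !addr0.
  by move=> /eqP; rewrite mulf_eq0 orbb => /eqP.
(* In degree 3 the square now contributes nothing, so the cube of this coefficient is 0. *)
have B1 : B`_1 = 0.
  have := c 3 isT; rewrite exprS expr1 coefM !big_ord_recl big_ord0 /= A0 A1 !mul0r mulr0 !addr0.
  rewrite exprS coefM !big_ord_recl big_ord0 /= B0 B22 B21 B20 mul0r !mulr0 !addr0 !add0r.
  by move=> /esym/eqP; rewrite -exprS expf_eq0 /= => /eqP.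
have [j1|j1] := eqVneq j i1; first by move: aj; rewrite j1 -(tE 1) // A1 eqxx.
have [j2|j2] := eqVneq j i2; first by move: aj; rewrite j2 -(tE 1) // B1 eqxx.
have [j3|j3] := eqVneq j i3; last first.
  by have := congr1 (fun p : {poly C} => p`_1) (o0 j j1 j2 j3); rewrite tE // coef0 => /eqP; rewrite (negbTE aj).
have := congr1 (fun p : {poly C} => p`_1) p0.
rewrite coef_take_poly /= /harmonic_poly coefD coef0 coef_sum_scale big1 => [|m _].
  by rewrite addr0 coef_poly /= -j3 => /eqP; rewrite (negbTE aj).
by rewrite coef1_exp ?mulr0 // coef_poly /= ?a0 // -(tE 1).
Qed.

Lemma Delta1reg_lt : (Delta1reg defining_fun (0%R : V) < +oo)%E.
Proof.
apply: (@le_lt_trans _ _ (7%:R%:E)); last exact: ltry.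
apply: ge_ereal_sup => _ [a [ga o1 ->]]; apply: ge_ereal_sup => _ [N vN <-].
by rewrite lee_fin ler_nat; exact: (regular_order ga o1 vN).
Qed.

(** * Singular curves of arbitrarily high contact *)

Lemma conv_coeffs_finite a M : (forall k j, (M <= k)%N -> a k j = 0) -> conv_coeffs a.
Proof.
move=> aM; exists (\sum_(k < M) \sum_j normc (a k j)), 1; split=> // k j.
rewrite expr1n mulr1; have [kM|/aM->] := ltnP k M; last first.
  by rewrite ComplexField.Normc.normc0; apply: sumr_ge0 => l _; apply: sumr_ge0 => m _; exact: normc_ge0.
rewrite (bigD1 (Ordinal kM)) //= (bigD1 j) //= -addrA lerDl addr_ge0 //.
  by apply: sumr_ge0 => m _; exact: normc_ge0.
by apply: sumr_ge0 => l _; apply: sumr_ge0 => m _; exact: normc_ge0.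
Qed.

Definition cusp_curve N : coeffs R n := fun k j =>
  if j == i1 then (k == 3)%:R else if j == i2 then (k == 2)%:R else
  if j == i3 then - (\sum_(m < N) (h m)%:C%C *: 'X^2 ^+ m.+1)`_k else 0.

Lemma cusp_curve_ord N : good_curve 0 (cusp_curve N) /\ curve_ord (cusp_curve N) 2.
Proof.
have i21 : i2 == i1 = false by rewrite eq_sym (negbTE n12).
have c k : (\sum_(m < N) (h m)%:C%C *: 'X^2 ^+ m.+1 : {poly C})`_k = \sum_(m < N) (h m)%:C%C * (k == 2 * m.+1)%N%:R.
  by rewrite coef_sum; apply: eq_bigr => m _; rewrite coefZ -exprM coefXn.
have a2 : cusp_curve N 2 i2 != 0 by rewrite /cusp_curve i21 eqxx oner_neq0.
have low k j : (k < 2)%N -> cusp_curve N k j = 0.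
  move=> k2; rewrite /cusp_curve c big1 ?oppr0 => [|m _]; last first.
    by rewrite (_ : (k == 2 * m.+1)%N = false) ?mulr0 // ltn_eqF // (leq_trans k2) // leq_pmulr.
  have -> : (k == 3) = false by rewrite ltn_eqF // ltnW.
  have -> : (k == 2) = false by rewrite ltn_eqF.
  by case: ifP => // _; case: ifP => // _; case: ifP.
split; last by split=> //; split; [exists i2|move=> k j /andP[_]; exact: low].
split; last by exists 2%N, i2.
  apply: (@conv_coeffs_finite _ (4 + 2 * N.+1)) => k j kN.
  rewrite /cusp_curve c big1 ?oppr0 => [|m _]; last first.
    rewrite (_ : (k == 2 * m.+1)%N = false) ?mulr0 // gtn_eqF // (leq_trans _ kN) //.
    by move: (ltn_ord m); clear; lia.
  have k4 : (4 <= k)%N by rewrite (leq_trans _ kN) // leq_addr.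
  have -> : (k == 3) = false by rewrite gtn_eqF.
  have -> : (k == 2) = false by rewrite gtn_eqF // ltnW.
  by case: ifP => // _; case: ifP => // _; case: ifP.
by move=> j; rewrite low // zcoord0.
Qed.

(** Along this curve the cusp equation and the harmonic part cancel identically in the truncations;
    N >= 3 keeps t^3 from being truncated. *)
Lemma cusp_curve_vanishes N : (3 <= N)%N -> vanishes_to (defining_fun \o curve_eval (cusp_curve N)) N.+1.
Proof.
move=> N3; have [gc _] := cusp_curve_ord N; have [ca a0] := good_curve0 gc.
set a := cusp_curve N in ca a0 *.
have i21 : i2 == i1 = false by rewrite eq_sym (negbTE n12).
have i31 : i3 == i1 = false by rewrite eq_sym (negbTE n13).
have i32 : i3 == i2 = false by rewrite eq_sym (negbTE n23).
have t1 : trunc a N.+1 i1 = 'X^3.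
  apply/polyP => k; rewrite coef_poly coefXn /a /cusp_curve eqxx.
  by case: ifP => // /negbT; rewrite -leqNgt => kN; rewrite gtn_eqF // (leq_trans _ kN).
have t2 : trunc a N.+1 i2 = 'X^2.
  apply/polyP => k; rewrite coef_poly coefXn /a /cusp_curve eqxx i21.
  by case: ifP => // /negbT; rewrite -leqNgt => kN; rewrite gtn_eqF // (leq_trans _ kN) // ltnW.
have p0 : take_poly N.+1 (harmonic_poly a N) = 0.
  apply/polyP => k; rewrite coef_take_poly coef0; case: ifP => // kN.
  rewrite /harmonic_poly t2 coefD coef_poly kN {1}/a /cusp_curve i31 i32 eqxx.
  exact: addNr.
have [B1 [d1 [d10 H1]]] := curve_expansion N ca a0.
have [K [d2 [d20 H2]]] := cusp_approx N.+1 ca a0.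
have [K' [d3 [K'0 d30 H3]]] := curve_approx N.+1 ca.
exists (B1 + (K ^+ 2 + \sum_(j <- others) K' ^+ 2)), (Num.min (Num.min d1 d2) (Num.min d3 1)).
split; first by rewrite !lt_min d10 d20 d30 ltr01.
move=> t; rewrite !lt_min => /andP[/andP[td1 td2] /andP[td3 td4]].
have t0 := normc_ge0 t; have Z0 : 0 <= normc t ^+ N.+1 by rewrite exprn_ge0.
have := H1 t td1; rewrite p0 horner0 add0r => h1.
have sqZ (u L : R) : 0 <= u -> u <= L * normc t ^+ N.+1 -> u ^+ 2 <= L ^+ 2 * normc t ^+ N.+1.
  move=> u0 uL; apply: (@le_trans _ _ ((L * normc t ^+ N.+1) ^+ 2)).
    by rewrite lerXn2r ?nnegrE // (le_trans u0).
  rewrite exprMn ler_wpM2l ?sqr_ge0 // [leLHS]expr2 ler_piMl // exprn_ile1 // ltW //.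
have h2 : squares (curve_eval a t) <= (K ^+ 2 + \sum_(j <- others) K' ^+ 2) * normc t ^+ N.+1.
  rewrite mulrDl; apply: lerD.
    apply: sqZ; first exact: normc_ge0.
    by have := H2 t td2; rewrite t1 t2 -!exprM subrr horner0 subr0.
  rewrite mulr_suml big_seq [leRHS]big_seq; apply: ler_sum => j.
  rewrite mem_filter => /andP[/and3P[j1 j2 j3] _]; apply: sqZ; first exact: normc_ge0.
  have := H3 j t td3; rewrite (_ : trunc a N.+1 j = 0) ?horner0 ?subr0 //.
  apply/polyP => k; rewrite coef_poly coef0 /a /cusp_curve (negbTE j1) (negbTE j2) (negbTE j3).
  by case: ifP.
have s0 : 0 <= squares (curve_eval a t).
  by rewrite addr_ge0 ?sqr_ge0 // sumr_ge0 // => j _; exact: sqr_ge0.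
rewrite /= mulrDl.
rewrite (_ : defining_fun _ = (defining_fun (curve_eval a t) - squares (curve_eval a t)) + squares (curve_eval a t)); last by rewrite subrK.
apply: le_trans (ler_normD _ _) (lerD h1 _).
by rewrite ger0_norm.
Qed.

Lemma Delta1_infty : Delta1 defining_fun 0 = +oo%E.
Proof.
apply/eqyP => A A0.
(* The contact N + 1 is divided by the order 2 of the curve, hence 2A. *)
pose N := (3 + Num.bound (2 * A))%N.
have [gc oc] := cusp_curve_ord N.
have vN := cusp_curve_vanishes (leq_addr _ _ : (3 <= N)%N).
apply: (@le_trans _ _ (ord_van (defining_fun \o curve_eval (cusp_curve N)) * ((2%:R)^-1)%:E)%E); last first.
  by apply: ereal_sup_ubound; exists (cusp_curve N), 2%N.
apply: (@le_trans _ _ ((N.+1%:R)%:E * ((2%:R)^-1)%:E)%E).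
  rewrite -EFinM lee_fin ler_pdivlMr // mulrC; apply: ltW.
  apply: lt_le_trans (archi_boundP _) _; first by rewrite mulr_ge0 // ltW.
  by rewrite ler_nat; apply: leqW; exact: leq_addl.
apply: lee_wpmul2r; first by rewrite lee_fin invr_ge0.
by apply: ereal_sup_ubound; exists N.+1.
Qed.

(** * Absence of curves of infinite contact *)

Lemma shifted_sum_harmonic N (q : {poly C}) :
  \sum_(m < N) (h m)%:C%C *: q ^+ m.+1 = shifted_sum q [seq (h m)%:C%C | m <- iota 0 N].
Proof.
rewrite shifted_sumE size_map size_iota; apply: eq_bigr => m _.
by rewrite (nth_map 0%N) ?size_iota // nth_iota.
Qed.

Lemma no_tangent a : good_curve 0 a -> ~ tangent_inf defining_fun a.
Proof.
move=> ga tinf; have [ca a0] := good_curve0 ga; have [_ _ [k0 [j0 [k00 ak0]]]] := ga.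
have vc M := vanishes_coefs (M := M) ca a0 (tinf _).
have other0 k j : j != i1 -> j != i2 -> j != i3 -> a k j = 0.
  move=> j1 j2 j3; have [_ _ /(_ j j1 j2 j3)] := vc k.
  by move=> /(congr1 (fun p : {poly C} => p`_k)); rewrite coef_poly ltnS leqnn coef0.
have W N k : (k <= N)%N -> a k i3 + (\sum_(m < N) (h m)%:C%C *: trunc a N.+1 i2 ^+ m.+1)`_k = 0.
  move=> kN; have [p0 _] := vanishes_consequence ca a0 (tinf N.+1).
  have := congr1 (fun p : {poly C} => p`_k) p0.
  by rewrite coef_take_poly ltnS kN coef0 /harmonic_poly coefD coef_poly ltnS kN.
have [b0|] := pselect (forall k, a k i2 = 0).
  have t0 N : trunc a N i2 = 0.
    by apply/polyP => k; rewrite coef_poly b0 coef0; case: ifP.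
  have w0 k : a k i3 = 0.
    have := W k k (leqnn k); rewrite t0 big1 ?coef0 ?addr0 // => m _.
    by rewrite expr0n scaler0.
  have z0 k : a k i1 = 0.
    elim/ltn_ind: k => k IH.
    (* With z2 = 0 the series z1^2 vanishes; once the coefficients of z1 below k are 0, its
       coefficient of degree 2k is the square of the k-th. *)
    have [_ + _] := vc (2 * k)%N; rewrite t0 expr0n subr0.
    move=> /(congr1 (fun p : {poly C} => p`_(2 * k))).
    have kk : (k < (2 * k).+1)%N by rewrite ltnS leq_pmull.
    rewrite coef_take_poly ltnSn coef0 expr2 coefM (bigD1 (Ordinal kk)) //= big1 ?addr0.
      have kE : (2 * k - k = k)%N by rewrite mul2n -addnn addnK.
      rewrite kE !coef_poly kk => /eqP.
      by rewrite mulf_eq0 orbb => /eqP.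
    move=> [l lk] /= lNk; rewrite !coef_poly.
    have [lt|lt|eq] := ltngtP l k.
    - by rewrite (IH l) // if_same mul0r.
    - rewrite (IH (2 * k - l)%N) ?if_same ?mulr0 //.
      by move: lt (lk); clear; lia.
    - by move: lNk; rewrite -val_eqE /= eq eqxx.
  move: ak0; have [->|j1] := eqVneq j0 i1; first by rewrite z0 eqxx.
  have [->|j2] := eqVneq j0 i2; first by rewrite b0 eqxx.
  have [->|j3] := eqVneq j0 i3; first by rewrite w0 eqxx.
  by rewrite other0 ?eqxx.
move=> /existsNP [k1 /eqP k1n].
have ex0 : exists k, a k i2 != 0 by exists k1.
pose d := ex_minn ex0.
have [ad dmin] : a d i2 != 0 /\ forall k, (k < d)%N -> a k i2 = 0.
  rewrite /d; case: ex_minnP => d' ad' mn; split=> // k kd.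
  by apply/eqP; apply: contraTT kd => /mn; rewrite -leqNgt.
have d0 : (0 < d)%N by rewrite lt0n; apply: contraNneq ad => ->; rewrite a0.
have [B [rho [rho0 HB]]] := ca.
have B0 : 0 <= B by apply: le_trans (HB 0%N i1); rewrite mulr_ge0 ?normc_ge0 // exprn_ge0 // ltW.
have nd0 : 0 < normc (a d i2).
  rewrite lt_neqAle normc_ge0 andbT eq_sym; apply: contra ad => /eqP.
  by move/ComplexField.Normc.eq0_normc => ->.
pose E := normc (a d i2) * rho ^+ d / (4 * B + 1).
have E0 : 0 < E by rewrite divr_gt0 ?mulr_gt0 ?exprn_gt0 // ltr_wpDl // mulr_ge0.
(* The pair (s, rho) plays the role of (r, s) in [division_bound]: the first bound gives s <= rho/2,
   and E is chosen so that the second gives the smallness condition [Br]. *)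
pose s := Num.min (rho / 2) (rho * E).
have s0 : 0 < s by rewrite lt_min divr_gt0 // mulr_gt0.
have s2 : s <= rho / 2 by rewrite ge_min lexx.
have sE : s / rho <= E by rewrite ler_pdivrMr // mulrC ge_min lexx orbT.
(* Neither the ratio nor B depends on a truncation order, so m can be fixed before N. *)
have [m] := hbig (2 / (s ^+ d * normc (a d i2))) B.
apply/negP; rewrite -leNgt.
(* The precision used up by m + 1 divisions by z2, which vanishes to order d. *)
pose N := (d * m.+1)%N.
have mN : (m < N)%N by rewrite leq_pmull.
have dN : (d < N.+1)%N by rewrite ltnS leq_pmulr.
have cb k : (trunc a N.+1 i2)`_k = if (k < N.+1)%N then a k i2 else 0 by rewrite coef_poly.
have cd : (trunc a N.+1 i2)`_d = a d i2 by rewrite cb dN.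
have bd0 k : (k < d)%N -> (trunc a N.+1 i2)`_k = 0.
  by move=> kd; rewrite cb dmin // if_same.
have bdn0 : 0 < normc (trunc a N.+1 i2)`_d by rewrite cd.
have Bb k : normc (trunc a N.+1 i2)`_k <= B / rho ^+ k.
  rewrite cb; case: ifP => _; first by rewrite ler_pdivlMr ?exprn_gt0.
  by rewrite ComplexField.Normc.normc0 divr_ge0 // exprn_ge0 // ltW.
have Br : 4 * B / rho ^+ d * (s / rho) <= normc (trunc a N.+1 i2)`_d.
  have P0 : 0 <= 4 * B / rho ^+ d by rewrite divr_ge0 ?mulr_ge0 // exprn_ge0 // ltW.
  apply: le_trans (ler_wpM2l P0 sE) _; rewrite cd.
  have B1 : 0 < 4 * B + 1 by rewrite ltr_wpDl // mulr_ge0.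
  rewrite (_ : _ * E = normc (a d i2) * (4 * B / (4 * B + 1))); last first.
    by rewrite /E; field; rewrite expf_neq0 ?gt_eqF.
  by rewrite ler_piMr ?normc_ge0 // ler_pdivrMr // mul1r lerDl.
have HV k : (k <= N)%N ->
    normc (shifted_sum (trunc a N.+1 i2) [seq (h m)%:C%C | m <- iota 0 N])`_k <= B / s ^+ k.
  move=> kN; rewrite -shifted_sum_harmonic.
  have -> : (\sum_(m < N) (h m)%:C%C *: trunc a N.+1 i2 ^+ m.+1)`_k = - a k i3.
    by apply/eqP; rewrite -addr_eq0 addrC W.
  rewrite (normcN (a k i3 : Rcomplex R)) ler_pdivlMr ?exprn_gt0 //.
  apply: le_trans (HB k i3); rewrite ler_wpM2l ?normc_ge0 // lerXn2r ?nnegrE ?(ltW s0) ?(ltW rho0) //.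
  by apply: le_trans s2 _; rewrite ler_pdivrMr // ler_peMr ?(ltW rho0) // ler1n.
have := shifted_sum_coef_bound s0 s2 d0 bd0 bdn0 B0 Bb Br B0 HV (i := m).
rewrite size_map size_iota => /(_ mN (leqnn _)).
rewrite (nth_map 0%N) ?size_iota // nth_iota // add0n normc_real cd => hm.
by rewrite mulrC; apply: le_trans (ler_norm _) hm.
Qed.

End WithPotential.
End Hypersurface.

Theorem theorem6p6 (R : realType) (n : nat) (hn : (2 <= n)%N) :
  exists (r : pt R n -> R) (U : set (pt R n)) (p : pt R n),
    [/\ open U, U p, r p = 0,
        smooth_on U r /\ (forall x, U x -> r x = 0 -> grad_nonzero r x)
      & [/\ pseudoconvex_on U r,
            Delta1 r p = +oo%E,
            (Delta1reg r p < +oo)%E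
          & forall a, good_curve p a -> ~ tangent_inf r a]].
Proof.
(* Since n >= 2, coordinates 0, 1 and 2 exist and are distinct; they serve as z1, z2 and w. *)
pose i (k : nat) : 'I_n.+1 := inord k.
have ineq k l : (k <= 2)%N -> (l <= 2)%N -> k != l -> i k != i l.
  by move=> k2 l2; apply: contra => /eqP /(congr1 val); rewrite /= !inordK ?ltnS ?(leq_trans _ hn) // => ->.
have n01 : i 0%N != i 1%N by exact: ineq.
have n02 : i 0%N != i 2%N by exact: ineq.
have n12 : i 1%N != i 2%N by exact: ineq.
have [F [h [eF dF pF F0 [Fh hbig]]]] := exists_potential R (i 1%N).
exists (defining_fun (i 0%N) (i 1%N) (i 2%N) F), (@box R n), 0; split.
- exact: box_open.
- exact: box0.
- exact: (defining_fun0 _ _ dF Fh).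
- split; first exact: (defining_fun_smooth _ _ _ eF dF).
  by move=> x bx _; exact: (defining_fun_grad n02 n12 eF dF F0 bx).
split.
- exact: (defining_fun_psh eF dF pF).
- exact: (Delta1_infty n01 n02 n12 dF Fh).
- exact: (Delta1reg_lt _ _ dF Fh).
- exact: (no_tangent dF Fh hbig).
Qed.
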